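(* Let $C$ be a generalized Cantor ladder with $m\ge2$ steps such that $\rho_m=\min_{1\le i\le m}\rho_i$. Then every $\varsigma\in\mathfrak{I}$ satisfies $\varsigma>1$, and there is $\Lambda>0$ such that for all $\lambda\ge\Lambda$ $$E(\lambda)=H(\lambda)\lambda^\alpha e^\lambda-\left(\frac{\Delta_{2m-2}}{\Delta_{2m-1}}+\Delta_{2m-3}\,H\Big(\frac{\rho_{m-1}}{\rho_m}\lambda\Big)(\rho_{m-1}\lambda)^\alpha\right)+\sum_{\varsigma\in\mathfrak{I}}c_\varsigma(\lambda)e^{(1-\varsigma)\lambda},$$ where the series converges uniformly on $[\Lambda,\infty)$. The exponent set $\mathfrak{I}$ and the coefficient functions $c_\varsigma$ are those defined in the context.
   Context: Generalized Cantor ladder with $m$ steps ($m\ge2$): let $I_k=[a_k,b_k]\subset[0,1]$, $k=1,\dots,m$, with $a_k<b_k$, $b_k\le a_{k+1}$, $a_1=0$, $b_m=1$, and let $\rho_1,\dots,\rho_m>0$ with $\sum_k\rho_k=1$. Put $\Delta_{2k-1}=b_k-a_k>0$ ($1\le k\le m$), $\Delta_{2k}=a_{k+1}-b_k\ge0$ ($1\le k\le m-1$), $h_0=0$, $h_k=\sum_{i=1}^k\rho_i$, $g_k=1-h_k$. The ladder is the unique continuous function $C:[0,1]\to[0,1]$ with $C(0)=0$, $C(1)=1$ such that $C(t)=h_{k-1}+\rho_kC\big(\frac{t-a_k}{\Delta_{2k-1}}\big)$ for $t\in[a_k,b_k]$ and $C(t)=h_k$ for $t\in[b_k,a_{k+1}]$.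 It is monotone. For $\lambda\ge0$ let $E(\lambda)=\int_0^1e^{\lambda C(t)}\,dt$. Put $\eta=1/\rho_m>1$ and $\alpha=\log_\eta(\Delta_{2m-1})<0$. The function $H$: put $f(\lambda)=E(\eta\lambda)-\Delta_{2m-1}e^{(\eta-1)\lambda}E(\lambda)$, $f_1(\lambda)=\dfrac{f(\lambda)}{\Delta_{2m-1}\lambda^\alpha e^{\eta\lambda}}$, and $H(\lambda)=\sum_{k\in\mathbb{Z}}f_1(\eta^k\lambda)$ for $\lambda>0$ (the series converges). Then $H(\lambda)=\Phi(\log_\eta\lambda)$ with $\Phi$ $1$-periodic; equivalently, $H$ is the unique function on $(0,\infty)$ of this form such that $E(\lambda)=H(\lambda)\lambda^\alpha e^\lambda+O(1)$ as $\lambda\to\infty$. Write $H_1(\lambda)=H(\lambda)\lambda^\alpha$. Exponents: $\mathfrak{I}_1=\{\eta g_k:1\le k\le m-1\}$ (note $\eta g_{m-1}=1$). Let $\widehat{\mathfrak{I}}\subset\mathbb{R}$ be the smallest set containing $\mathfrak{I}_1$ and closed under the maps $\varsigma\mapsto\eta\varsigma$ and $\varsigma\mapsto\eta(g_i+\rho_i\varsigma)$, $1\le i\le m-1$. Put $\mathfrak{I}=\widehat{\mathfrak{I}}\setminus\{1\}$. Under the assumption $\rho_m=\min_i\rho_i$ the set $\mathfrak{I}$ is countable and has no finite accumulation points; sums over it are taken in increasing order of $\varsigma$. Coefficients: for $1\le k\le m-1$ put $c^1_{\eta g_k}(\lambda)=-\dfrac{\Delta_{2k-1}H_1(\eta\rho_k\lambda)+\Delta_{2k}}{\Delta_{2m-1}}$,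 and $c^1_\varsigma\equiv0$ for $\varsigma\notin\mathfrak{I}_1$. The functions $c_\varsigma:(0,\infty)\to\mathbb{R}$ are defined by $c_\varsigma\equiv0$ for $\varsigma\notin\widehat{\mathfrak{I}}$ and, recursively in increasing $\varsigma\in\widehat{\mathfrak{I}}$, by $$c_\varsigma(\lambda)=c^1_\varsigma(\lambda)+\frac1{\Delta_{2m-1}}c_{\varsigma/\eta}(\eta\lambda)-\sum_{i=1}^{m-1}\frac{\Delta_{2i-1}}{\Delta_{2m-1}}\,c_{(\varsigma/\eta-g_i)/\rho_i}(\rho_i\eta\lambda)$$ (all indices on the right that lie in $\widehat{\mathfrak{I}}$ are smaller than $\varsigma$). *)

(* Defs.v *)
From Stdlib Require Import Reals ZArith Lra Lia Psatz ClassicalDescription.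
From Coquelicot Require Import Coquelicot.

(** Stdlib reals with Coquelicot.  The steps are numbered from 1 to [steps]; the
    values of [a], [b], [rho] outside this range are never used. *)

Open Scope R_scope.

Record ladder_data := LadderData {
  steps : nat;
  a : nat -> R;
  b : nat -> R;
  rho : nat -> R;
  steps_ge2 : (2 <= steps)%nat;
  interval_sub : forall k, (1 <= k <= steps)%nat -> 0 <= a k /\ b k <= 1;
  interval_lt : forall k, (1 <= k <= steps)%nat -> a k < b k;
  interval_ord : forall k, (1 <= k <= steps - 1)%nat -> b k <= a (k + 1);
  a_first : a 1 = 0;
  b_last : b steps = 1;
  rho_pos : forall k, (1 <= k <= steps)%nat -> 0 < rho k;
  rho_sum : sum_n_m rho 1 steps = 1
}.

(** [len L k] is $\Delta_{2k-1}$ and [gap L k] is $\Delta_{2k}$. *)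
Definition len (L : ladder_data) (k : nat) : R := b L k - a L k.
Definition gap (L : ladder_data) (k : nat) : R := a L (k + 1) - b L k.

Definition h (L : ladder_data) (k : nat) : R := sum_n_m (rho L) 1 k.
Definition g (L : ladder_data) (k : nat) : R := 1 - h L k.

Definition eta (L : ladder_data) : R := 1 / rho L (steps L).
Definition alpha (L : ladder_data) : R := ln (len L (steps L)) / ln (eta L).

Definition unit_interval (t : R) : Prop := 0 <= t <= 1.

(** [C] is the ladder with data [L]; only its values on [0,1] matter. *)
Record is_ladder (L : ladder_data) (C : R -> R) : Prop := IsLadder {
  ladder_range : forall t, unit_interval t -> unit_interval (C t);
  ladder_cont : forall t, unit_interval t ->
    filterlim C (within unit_interval (locally t)) (locally (C t));
  ladder_0 : C 0 = 0;
  ladder_1 : C 1 = 1;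
  ladder_step : forall k t, (1 <= k <= steps L)%nat -> a L k <= t <= b L k ->
    C t = h L (k - 1) + rho L k * C ((t - a L k) / len L k);
  ladder_flat : forall k t, (1 <= k <= steps L - 1)%nat ->
    b L k <= t <= a L (k + 1) -> C t = h L k
}.

Definition E (C : R -> R) (lam : R) : R := RInt (fun t => exp (lam * C t)) 0 1.

Definition SeriesZ (u : Z -> R) : R :=
  Series (fun n => u (Z.of_nat n)) + Series (fun n => u (- Z.of_nat (S n))%Z).

Definition f (L : ladder_data) (C : R -> R) (lam : R) : R :=
  E C (eta L * lam) - len L (steps L) * exp ((eta L - 1) * lam) * E C lam.

Definition f1 (L : ladder_data) (C : R -> R) (lam : R) : R :=
  f L C lam / (len L (steps L) * Rpower lam (alpha L) * exp (eta L * lam)).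

Definition H (L : ladder_data) (C : R -> R) (lam : R) : R :=
  SeriesZ (fun k => f1 L C (powerRZ (eta L) k * lam)).

Definition H1 (L : ladder_data) (C : R -> R) (lam : R) : R :=
  H L C lam * Rpower lam (alpha L).

Inductive Ihat (L : ladder_data) : R -> Prop :=
| Ihat_base : forall k, (1 <= k <= steps L - 1)%nat -> Ihat L (eta L * g L k)
| Ihat_scale : forall s, Ihat L s -> Ihat L (eta L * s)
| Ihat_step : forall i s, (1 <= i <= steps L - 1)%nat -> Ihat L s ->
    Ihat L (eta L * (g L i + rho L i * s)).

Definition Iset (L : ladder_data) (s : R) : Prop := Ihat L s /\ s <> 1.

(** The numbers $\eta g_k$ are pairwise distinct, so at most one summand is
    nonzero, and none is if [s] is not of the form $\eta g_k$. *)
Definition c1 (L : ladder_data) (C : R -> R) (s lam : R) : R :=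
  sum_n_m (fun k =>
    if Req_EM_T s (eta L * g L k)
    then - (len L k * H1 L C (eta L * rho L k * lam) + gap L k) / len L (steps L)
    else 0) 1 (steps L - 1).

Definition c_rec (L : ladder_data) (C : R -> R) (c : R -> R -> R)
    (s lam : R) : R :=
  c1 L C s lam
  + 1 / len L (steps L) * c (s / eta L) (eta L * lam)
  - sum_n_m (fun i =>
      len L i / len L (steps L)
      * c ((s / eta L - g L i) / rho L i) (rho L i * eta L * lam))
    1 (steps L - 1).

(** [c s lam] is $c_s(\lambda)$.  If [rho L (steps L)] is the smallest of the
    [rho L i], these equations have a solution ([coefficients_exist] below) and
    determine [c s lam] for all [s] and all [lam > 0]. *)
Record is_coefficients (L : ladder_data) (C : R -> R) (c : R -> R -> R) : Prop :=
  IsCoefficients {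
  coef_out : forall s lam, 0 < lam -> ~ Ihat L s -> c s lam = 0;
  coef_rec : forall s lam, 0 < lam -> Ihat L s -> c s lam = c_rec L C c s lam
}.

Definition increasing_enumeration (A : R -> Prop) (s : nat -> R) : Prop :=
  (forall n, s n < s (S n)) /\ (forall x, A x <-> exists n, x = s n).

Lemma h_S L k : h L (S k) = h L k + rho L (S k).
Proof. unfold h. rewrite sum_n_Sm; [reflexivity | lia]. Qed.

Lemma g_ge L k : (k <= steps L - 1)%nat -> rho L (steps L) <= g L k.
Proof.
  intros Hk.
  assert (Hm := steps_ge2 L).
  assert (H1 : h L (steps L - 1) + rho L (steps L) = 1).
  { replace (steps L) with (S (steps L - 1)) at 2 by lia.
    rewrite <- h_S. replace (S (steps L - 1)) with (steps L) by lia.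
    exact (rho_sum L). }
  assert (Hinc : forall d, (k + d <= steps L - 1)%nat -> h L k <= h L (k + d)).
  { induction d as [|d IH]; intros Hd.
    - rewrite Nat.add_0_r; lra.
    - rewrite Nat.add_succ_r, h_S.
      assert (H2 := IH ltac:(lia)).
      assert (H3 := rho_pos L (S (k + d)) ltac:(lia)). lra. }
  specialize (Hinc (steps L - 1 - k)%nat ltac:(lia)).
  replace (k + (steps L - 1 - k))%nat with (steps L - 1)%nat in Hinc by lia.
  unfold g; lra.
Qed.

Lemma eta_rho L : eta L * rho L (steps L) = 1.
Proof.
  assert (Hm := steps_ge2 L). assert (Hp := rho_pos L (steps L) ltac:(lia)).
  unfold eta; field; lra.
Qed.

Lemma eta_gt1 L : 1 < eta L.
Proof.
  assert (Hm := steps_ge2 L). assert (Hp := rho_pos L (steps L) ltac:(lia)).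
  assert (Hg := g_ge L 1 ltac:(lia)). assert (H1 := rho_pos L 1 ltac:(lia)).
  assert (Hh : h L 1 = rho L 1) by (unfold h; apply sum_n_n).
  unfold g in Hg; rewrite Hh in Hg.
  assert (He := eta_rho L). nra.
Qed.

Lemma Ihat_ge1 L s : Ihat L s -> 1 <= s.
Proof.
  assert (He := eta_rho L). assert (H1 := eta_gt1 L).
  induction 1 as [k Hk | s _ IH | i s Hi _ IH].
  - assert (Hg := g_ge L k ltac:(lia)). nra.
  - nra.
  - assert (Hg := g_ge L i ltac:(lia)). assert (Hr := rho_pos L i ltac:(lia)).
    assert (rho L (steps L) <= g L i + rho L i * s) by nra. nra.
Qed.

Fixpoint coef_iter (L : ladder_data) (C : R -> R) (n : nat) (s lam : R) : R :=
  match n with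
  | O => 0
  | S n => if excluded_middle_informative (Ihat L s)
           then c_rec L C (coef_iter L C n) s lam else 0
  end.

Lemma coef_iter_out L C n s lam : ~ Ihat L s -> coef_iter L C n s lam = 0.
Proof.
  intros Hs; destruct n; simpl; [reflexivity|].
  destruct excluded_middle_informative; tauto.
Qed.

Lemma c_rec_ext L (Hmin : forall i, (1 <= i <= steps L)%nat ->
    rho L (steps L) <= rho L i) C c c' s lam : Ihat L s ->
  (forall p mu, p <= s - Rmin 1 (eta L - 1) -> c p mu = c' p mu) ->
  (forall p mu, ~ Ihat L p -> c p mu = c' p mu) ->
  c_rec L C c s lam = c_rec L C c' s lam.
Proof.
  intros Hs Hlo Hout.
  assert (He := eta_rho L). assert (He1 := eta_gt1 L).
  assert (Hs1 := Ihat_ge1 L s Hs).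
  assert (Hall : forall p mu, (Ihat L p -> p <= s - Rmin 1 (eta L - 1)) ->
    c p mu = c' p mu).
  { intros p mu Hp. destruct (excluded_middle_informative (Ihat L p)); auto. }
  unfold c_rec. apply (f_equal2 Rminus); [do 2 f_equal | apply sum_n_m_ext_loc].
  - apply Hall; intros Hp. assert (Hp1 := Ihat_ge1 L _ Hp).
    assert (Hd := Rmin_r 1 (eta L - 1)).
    set (p := s / eta L) in *.
    assert (s = eta L * p) by (unfold p; field; lra). nra.
  - intros i Hi. f_equal. apply Hall; intros Hp.
    assert (Hp1 := Ihat_ge1 L _ Hp).
    assert (Hd := Rmin_l 1 (eta L - 1)).
    assert (Hr := Hmin i ltac:(lia)). assert (Hg := g_ge L i ltac:(lia)).
    assert (Hpos := rho_pos L i ltac:(lia)).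
    set (p := (s / eta L - g L i) / rho L i) in *.
    assert (s = eta L * (g L i + rho L i * p)) by (unfold p; field; lra).
    assert (1 <= eta L * g L i) by nra.
    assert (1 <= eta L * rho L i) by nra. nra.
Qed.

Lemma coef_iter_stable L (Hmin : forall i, (1 <= i <= steps L)%nat ->
    rho L (steps L) <= rho L i) C n : forall n' s lam,
  s <= INR n * Rmin 1 (eta L - 1) -> s <= INR n' * Rmin 1 (eta L - 1) ->
  coef_iter L C n s lam = coef_iter L C n' s lam.
Proof.
  induction n as [|n IH]; intros n' s lam Hn Hn'.
  - simpl in Hn. rewrite !coef_iter_out; [reflexivity| |];
      intros Hs; assert (Hs1 := Ihat_ge1 L s Hs); lra.
  - destruct n' as [|n'].
    + simpl in Hn'. rewrite !coef_iter_out; [reflexivity| |];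
        intros Hs; assert (Hs1 := Ihat_ge1 L s Hs); lra.
    + simpl coef_iter. destruct excluded_middle_informative; [|reflexivity].
      rewrite S_INR in Hn, Hn'.
      apply c_rec_ext; trivial.
      * intros p mu Hp. apply IH; lra.
      * intros p mu Hp. now rewrite !coef_iter_out.
Qed.

Lemma coefficients_exist L (Hmin : forall i, (1 <= i <= steps L)%nat ->
    rho L (steps L) <= rho L i) C : exists c, is_coefficients L C c.
Proof.
  set (d := Rmin 1 (eta L - 1)).
  assert (Hd : 0 < d).
  { assert (He := eta_gt1 L). apply Rmin_case; lra. }
  set (N := fun s => Z.to_nat (up (s / d))).
  assert (HN : forall s, s <= INR (N s) * d).
  { intros s. unfold N.
    assert (Hu := proj1 (archimed (s / d))).
    assert (IZR (up (s / d)) <= INR (Z.to_nat (up (s / d)))).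
    { rewrite INR_IZR_INZ. apply IZR_le. lia. }
    assert (s / d * d = s) by (field; lra). nra. }
  exists (fun s => coef_iter L C (N s) s). split.
  - intros s lam _ Hs. now apply coef_iter_out.
  - intros s lam _ Hs.
    rewrite (coef_iter_stable L Hmin C (N s) (S (N s))).
    + change (coef_iter L C (S (N s)) s lam) with
        (if excluded_middle_informative (Ihat L s)
         then c_rec L C (coef_iter L C (N s)) s lam else 0).
      destruct excluded_middle_informative; [|tauto].
      apply c_rec_ext; trivial; fold d.
      * intros p mu Hp. apply coef_iter_stable; trivial; fold d.
        specialize (HN s). lra.
      * intros p mu Hp. now rewrite !coef_iter_out.
    + apply HN.
    + rewrite S_INR. fold d. specialize (HN s). lra.
Qed.

(* Main.v *)
(** Splitting the integral defining [E] along the steps gives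
    [E (eta lam) = D exp ((eta-1) lam) E lam + f lam], where [D] is the length of
    the last step and [f lam] is a combination of the [E (eta rho_k lam)], [k < m].
    Telescoping, [H1 lam] is the limit of [D^-n E (eta^n lam) exp (- eta^n lam)],
    and the remainder [R lam = E lam - H1 lam * exp lam] is bounded.  The functional
    equation becomes [R = R0 + T R], where [R0] is the sum of the terms with
    coefficients [c1] and [T] is linear.  By the recursion for the coefficients, the
    sum [P_X] of the terms with exponent index at most [X] satisfies the same equation
    with [X] replaced by smaller values inside [T], once [X >= eta].  Since
    [rho_m] is minimal, all arguments [eta rho_i lam] stay above [lam], and for large
    [lam] the operator [T] halves the supremum norm; hence [R - P_X] tends to 0
    uniformly.  The term of exponent index 1 is the bracket in the theorem. *)

Require Import Defs.
From Stdlib Require Import Reals Lra Lia List Permutation ClassicalEpsilon.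
From Coquelicot Require Import Coquelicot.
Import ListNotations.
Open Scope R_scope.

(** * Finite sums and locally finite sets *)

Definition lsum {A : Type} (u : A -> R) (l : list A) : R :=
  fold_right (fun x acc => u x + acc) 0 l.

Lemma lsum_app {A} (u : A -> R) l l' : lsum u (l ++ l') = lsum u l + lsum u l'.
Proof. induction l as [|x l IH]; simpl; [|rewrite IH]; ring. Qed.

Lemma lsum_map {A B} (u : B -> R) (p : A -> B) l :
  lsum u (map p l) = lsum (fun x => u (p x)) l.
Proof. induction l as [|x l IH]; simpl; [|rewrite IH]; reflexivity. Qed.

Lemma lsum_ext {A} (u v : A -> R) l :
  (forall x, In x l -> u x = v x) -> lsum u l = lsum v l.
Proof.
  induction l as [|x l IH]; simpl; intros Hl; [reflexivity|].
  rewrite Hl, IH; auto.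
Qed.

Lemma lsum_le {A} (u v : A -> R) l :
  (forall x, In x l -> u x <= v x) -> lsum u l <= lsum v l.
Proof.
  induction l as [|x l IH]; simpl; intros Hl; [lra|].
  apply Rplus_le_compat; auto.
Qed.

Lemma lsum_const0 {A} (l : list A) : lsum (fun _ => 0) l = 0.
Proof. induction l as [|x l IH]; simpl; [|rewrite IH]; ring. Qed.

Lemma lsum_nonneg {A} (u : A -> R) l :
  (forall x, In x l -> 0 <= u x) -> 0 <= lsum u l.
Proof. intros Hl. rewrite <- (lsum_const0 l). now apply lsum_le. Qed.

Lemma lsum_plus {A} (u v : A -> R) l :
  lsum (fun x => u x + v x) l = lsum u l + lsum v l.
Proof. induction l as [|x l IH]; simpl; [|rewrite IH]; ring. Qed.

Lemma lsum_minus {A} (u v : A -> R) l :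
  lsum (fun x => u x - v x) l = lsum u l - lsum v l.
Proof. induction l as [|x l IH]; simpl; [|rewrite IH]; ring. Qed.

Lemma lsum_scal {A} (r : R) (u : A -> R) l :
  lsum (fun x => r * u x) l = r * lsum u l.
Proof. induction l as [|x l IH]; simpl; [|rewrite IH]; ring. Qed.

Lemma lsum_abs {A} (u : A -> R) l : Rabs (lsum u l) <= lsum (fun x => Rabs (u x)) l.
Proof.
  induction l as [|x l IH]; simpl; [rewrite Rabs_R0; lra|].
  eapply Rle_trans; [apply Rabs_triang | lra].
Qed.

Lemma lsum_exchange {A B} (u : A -> B -> R) l l' :
  lsum (fun x => lsum (u x) l') l = lsum (fun y => lsum (fun x => u x y) l) l'.
Proof.
  induction l as [|x l IH]; simpl.
  - now rewrite lsum_const0.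
  - now rewrite IH, lsum_plus.
Qed.

Lemma lsum_perm {A} (u : A -> R) l l' : Permutation l l' -> lsum u l = lsum u l'.
Proof. induction 1; simpl; lra. Qed.

Lemma lsum_same {A} (u : A -> R) l l' :
  NoDup l -> NoDup l' -> (forall x, In x l <-> In x l') -> lsum u l = lsum u l'.
Proof. intros. now apply lsum_perm, NoDup_Permutation. Qed.

Lemma lsum_filter {A} (u : A -> R) (p : A -> bool) l :
  (forall x, In x l -> p x = false -> u x = 0) -> lsum u (filter p l) = lsum u l.
Proof.
  induction l as [|x l IH]; simpl; intros Hl; [reflexivity|].
  destruct (p x) eqn:Hp; simpl; rewrite IH; auto.
  rewrite (Hl x); auto; ring.
Qed.

(** Mapping [l] by the injective [p] gives a duplicate-free list covering [l']; entries outside [l']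
    contribute zero and are filtered away. In [partial_rec] the map [p] inverts a closure map of the
    exponent set. *)
Lemma lsum_reindex (u : R -> R) (p : R -> R) l l' :
  NoDup l -> NoDup l' -> (forall x y, p x = p y -> x = y) ->
  (forall x, In x l -> In (p x) l' \/ u (p x) = 0) ->
  (forall y, In y l' -> exists x, In x l /\ p x = y) ->
  lsum (fun x => u (p x)) l = lsum u l'.
Proof.
  intros Hl Hl' Hinj Hin Hsurj.
  rewrite <- lsum_map.
  set (q := fun y => if in_dec Req_EM_T y l' then true else false).
  rewrite <- (lsum_filter u q).
  - apply lsum_same; trivial.
    + apply NoDup_filter. apply FinFun.Injective_map_NoDup; trivial.
    + intros y. rewrite filter_In. unfold q.
      destruct in_dec as [Hy|Hy]; split; try tauto; [|intros [_ ?]; discriminate].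
      intros _. split; trivial. destruct (Hsurj y Hy) as [x [Hx <-]].
      now apply in_map.
  - intros y Hy Hq. apply in_map_iff in Hy as [x [<- Hx]].
    unfold q in Hq. destruct (in_dec Req_EM_T (p x) l'); [discriminate|].
    now destruct (Hin x Hx).
Qed.

Lemma lsum_indicator (r v : R) l : NoDup l ->
  lsum (fun x => if Req_EM_T x r then v else 0) l =
  if in_dec Req_EM_T r l then v else 0.
Proof.
  induction 1 as [|x l Hx Hl IH]; simpl; [reflexivity|].
  rewrite IH.
  destruct (Req_EM_T x r) as [->|Hr].
  - destruct (in_dec Req_EM_T r l); [tauto|].
    ring.
  - destruct (in_dec Req_EM_T r l); ring.
Qed.

Lemma sum_n_m_lsum (u : nat -> R) n : sum_n_m u 1 n = lsum u (seq 1 n).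
Proof.
  induction n as [|n IH].
  - now rewrite sum_n_m_zero by lia.
  - rewrite sum_n_Sm by lia. rewrite IH, seq_S, lsum_app. simpl.
    change plus with Rplus. ring.
Qed.

Lemma sum_n_lsum (u : nat -> R) n : sum_n u n = lsum u (seq 0 (S n)).
Proof.
  induction n as [|n IH].
  - rewrite sum_O. simpl. ring.
  - rewrite sum_Sn, IH, (seq_S (S n)), lsum_app. simpl.
    change plus with Rplus. ring.
Qed.

(** * Enumeration of locally finite sets of reals *)

Lemma list_min (l : list R) (P : R -> Prop) :
  (exists x, In x l /\ P x) ->
  exists y, In y l /\ P y /\ forall z, In z l -> P z -> y <= z.
Proof.
  induction l as [|x l IH]; intros [w [Hw Pw]]; [easy|].
  destruct (classic (exists v, In v l /\ P v)) as [Hex|Hno].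
  - destruct (IH Hex) as [y [Hy [Py Hmin]]].
    destruct (classic (P x /\ x <= y)) as [[Px Hxy]|Hx].
    + exists x; simpl; split; [|split]; auto.
      intros z [->|Hz] Pz; [lra|]. specialize (Hmin z Hz Pz); lra.
    + exists y; simpl; split; [|split]; auto.
      intros z [->|Hz] Pz; [|auto].
      apply Rnot_lt_le; intros Hlt; apply Hx; split; [trivial|lra].
  - exists w. destruct Hw as [->|Hw].
    + simpl; split; [|split]; auto.
      intros z [->|Hz] Pz; [lra|]. exfalso; eauto.
    + exfalso; eauto.
Qed.

(** The successor map, sending a real to the least element of [A] above it, is iterated from a lower
    bound of [A]. An element missed by the iteration would lie above infinitely many distinct
    elements of [A], against local finiteness. *)
Lemma locally_finite_enumeration (A : R -> Prop) :
  (forall X, exists l, forall x, A x -> x <= X -> In x l) ->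
  (forall X, exists x, A x /\ X < x) ->
  (exists X, forall x, A x -> X < x) ->
  exists s, increasing_enumeration A s.
Proof.
  intros Hfin Hunb [X0 HX0].
  assert (Hnext : forall X, exists y, A y /\ X < y /\ forall z, A z -> X < z -> y <= z).
  { intros X. destruct (Hunb X) as [x [Ax Hx]]. destruct (Hfin x) as [l Hl].
    destruct (list_min l (fun z => A z /\ X < z)) as [y [_ [[Ay Hy] Hmin]]].
    - exists x. split; [apply Hl; [trivial|lra] | auto].
    - exists y. split; [|split]; trivial. intros z Az Hz.
      destruct (Rle_dec z x) as [Hzx|Hzx].
      + apply Hmin; auto.
      + assert (y <= x) by (apply Hmin; [apply Hl; [trivial|lra] | auto]). lra. }
  set (next := fun X => proj1_sig (constructive_indefinite_description _ (Hnext X))).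
  assert (HN : forall X, A (next X) /\ X < next X /\
            forall z, A z -> X < z -> next X <= z).
  { intros X. unfold next.
    now destruct (constructive_indefinite_description _ (Hnext X)). }
  (* The successor map is applied once already at index 0, since [X0] lies strictly below [A]. *)
  set (s := fun n => Nat.iter (S n) next X0).
  assert (HS : forall n, s (S n) = next (s n)) by reflexivity.
  assert (Hinc : forall n, s n < s (S n)) by (intros n; rewrite HS; apply HN).
  assert (HA : forall n, A (s n)) by (intros n; apply HN).
  exists s. split; trivial.
  intros x. split; [|intros [n ->]; auto].
  intros Ax. apply NNPP; intros Hno.
  assert (Hlt : forall n, s n < x).
  { induction n as [|n IH].
    - assert (s 0%nat <= x) by (apply HN; auto).
      destruct (Req_dec (s 0%nat) x); [exfalso; eauto | lra].
    - assert (s (S n) <= x) by (rewrite HS; apply HN; auto).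
      destruct (Req_dec (s (S n)) x); [exfalso; eauto | lra]. }
  destruct (Hfin x) as [l Hl].
  assert (Hmono : forall n k, s n < s (n + S k)%nat).
  { intros n; induction k as [|k IH].
    - replace (n + 1)%nat with (S n) by lia. auto.
    - replace (n + S (S k))%nat with (S (n + S k)) by lia.
      specialize (Hinc (n + S k)%nat). lra. }
  (* Pigeonhole: these [length l + 1] values are distinct, yet all of them lie in [l]. *)
  assert (Hnd : NoDup (map s (seq 0 (S (length l))))).
  { apply FinFun.Injective_map_NoDup; [|apply seq_NoDup].
    intros i j Hij. destruct (Nat.lt_total i j) as [H|[H|H]]; trivial.
    - specialize (Hmono i (j - i - 1)%nat).
      replace (i + S (j - i - 1))%nat with j in Hmono by lia. lra.
    - specialize (Hmono j (i - j - 1)%nat).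
      replace (j + S (i - j - 1))%nat with i in Hmono by lia. lra. }
  apply NoDup_incl_length with (l' := l) in Hnd.
  - rewrite length_map, length_seq in Hnd. lia.
  - intros y Hy. apply in_map_iff in Hy as [n [<- _]].
    apply Hl; [auto | left; auto].
Qed.

Lemma enumeration_le (A : R -> Prop) s : increasing_enumeration A s ->
  forall i j, s i <= s j <-> (i <= j)%nat.
Proof.
  intros [Hinc _].
  assert (Hmono : forall n k, s n <= s (n + k)%nat).
  { intros n; induction k as [|k IH]; [rewrite Nat.add_0_r; lra|].
    rewrite Nat.add_succ_r. specialize (Hinc (n + k)%nat). lra. }
  intros i j. split; intros Hij.
  - apply Nat.nlt_ge; intros Hji. specialize (Hmono (S j) (i - S j)%nat).
    replace (S j + (i - S j))%nat with i in Hmono by lia.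
    specialize (Hinc j). lra.
  - replace j with (i + (j - i))%nat by lia. apply Hmono.
Qed.

(** * The exponent set *)

Section Exponents.

Context (L : ladder_data).

Lemma h_monotone i j : (i <= j <= steps L)%nat -> h L i <= h L j.
Proof.
  intros Hij. replace j with (i + (j - i))%nat by lia.
  assert (Hd : (i + (j - i) <= steps L)%nat) by lia. revert Hd.
  induction (j - i)%nat as [|d IH]; intros Hd; [rewrite Nat.add_0_r; lra|].
  rewrite Nat.add_succ_r, h_S.
  assert (Hr := rho_pos L (S (i + d)) ltac:(lia)). specialize (IH ltac:(lia)). lra.
Qed.

Lemma h_0 : h L 0 = 0.
Proof. unfold h. rewrite sum_n_m_zero by lia. reflexivity. Qed.

Lemma h_steps : h L (steps L) = 1.
Proof. exact (rho_sum L). Qed.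

Lemma h_pred k : (1 <= k)%nat -> h L (k - 1) = h L k - rho L k.
Proof.
  intros Hk. replace k with (S (k - 1)) at 2 3 by lia. rewrite h_S. ring.
Qed.

Lemma eta_pos : 0 < eta L.
Proof. assert (H := eta_gt1 L). lra. Qed.

Lemma eta_g_ge1 k : (k <= steps L - 1)%nat -> 1 <= eta L * g L k.
Proof.
  intros Hk. rewrite <- (eta_rho L). apply Rmult_le_compat_l.
  - apply Rlt_le, eta_pos.
  - now apply g_ge.
Qed.

Lemma g_le1 k : (k <= steps L)%nat -> g L k <= 1.
Proof.
  intros Hk. unfold g. assert (H := h_monotone 0 k ltac:(lia)).
  rewrite h_0 in H. lra.
Qed.

Lemma Ihat_1 : Ihat L 1.
Proof.
  assert (Hm := steps_ge2 L).
  replace 1 with (eta L * g L (steps L - 1)); [constructor; lia|].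
  rewrite <- (eta_rho L). f_equal. unfold g.
  rewrite h_pred, h_steps by lia. ring.
Qed.

(** The powers of [eta], obtained from the exponent 1 by scaling, exceed every bound. *)
Lemma Ihat_unbounded X : exists s, Ihat L s /\ X < s.
Proof.
  assert (He := eta_gt1 L).
  destruct (Pow_x_infinity (eta L)) with (b := X + 1) as [n Hn].
  - rewrite Rabs_right; lra.
  - exists (eta L ^ n). split.
    + clear Hn. induction n as [|n IH]; simpl; [apply Ihat_1|].
      now constructor.
    + specialize (Hn n (le_n n)).
      rewrite Rabs_right in Hn by (apply Rle_ge, pow_le; lra). lra.
Qed.

Context (Hmin : forall i, (1 <= i <= steps L)%nat -> rho L (steps L) <= rho L i).

Lemma eta_rho_ge1 i : (1 <= i <= steps L)%nat -> 1 <= eta L * rho L i.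
Proof.
  intros Hi. rewrite <- (eta_rho L). apply Rmult_le_compat_l; auto.
  apply Rlt_le, eta_pos.
Qed.

(** A lower bound for the increase of an index [s >= 1] under the closure maps: scaling adds at
    least [eta - 1], and the map for step [i] adds at least 1, because [eta * g i] and [eta * rho i]
    are at least 1. *)
Definition min_gap : R := Rmin 1 (eta L - 1).

Lemma min_gap_pos : 0 < min_gap.
Proof. unfold min_gap. assert (H := eta_gt1 L). apply Rmin_case; lra. Qed.

(** Induction over multiples of [min_gap]: an exponent up to the next multiple is a base exponent or
    the image of one up to the current multiple, and there are finitely many closure maps. *)
Lemma Ihat_finite X : exists l, forall s, Ihat L s -> s <= X -> In s l.
Proof.
  assert (Hd := min_gap_pos).
  assert (Hn : forall n, exists l, forall s, Ihat L s -> s <= INR n * min_gap -> In s l).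
  { induction n as [|n [l Hl]].
    - exists []. simpl. intros s Hs Hle. assert (H := Ihat_ge1 L s Hs). lra.
    - exists (map (fun k => eta L * g L k) (seq 1 (steps L - 1))
              ++ map (fun s => eta L * s) l
              ++ flat_map (fun i => map (fun s => eta L * (g L i + rho L i * s)) l)
                   (seq 1 (steps L - 1))).
      intros s Hs Hle. rewrite S_INR in Hle.
      assert (He := eta_gt1 L). assert (Hd1 := Rmin_l 1 (eta L - 1)).
      assert (Hd2 := Rmin_r 1 (eta L - 1)). fold min_gap in Hd1, Hd2.
      rewrite !in_app_iff.
      destruct Hs as [k Hk | s Hs | i s Hi Hs].
      + left. apply in_map_iff. exists k. split; trivial. apply in_seq; lia.
      + right; left. apply in_map, Hl; trivial.
        assert (H := Ihat_ge1 L s Hs). nra.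
      + right; right. apply in_flat_map. exists i. split; [apply in_seq; lia|].
        apply in_map_iff. exists s. split; trivial. apply Hl; trivial.
        assert (H := Ihat_ge1 L s Hs).
        assert (Hg := eta_g_ge1 i ltac:(lia)).
        assert (Hr := eta_rho_ge1 i ltac:(lia)). nra. }
  destruct (archimed (X / min_gap)) as [Hup _].
  destruct (Hn (Z.to_nat (up (X / min_gap)))) as [l Hl].
  exists l. intros s Hs Hle. apply Hl; trivial.
  assert (IZR (up (X / min_gap)) <= INR (Z.to_nat (up (X / min_gap)))).
  { rewrite INR_IZR_INZ. apply IZR_le. lia. }
  assert (X / min_gap * min_gap = X) by (field; lra). nra.
Qed.

Lemma Ihat_upto_ex X : exists l, NoDup l /\ forall s, In s l <-> Ihat L s /\ s <= X.
Proof.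
  destruct (Ihat_finite X) as [l Hl].
  set (p := fun s => if excluded_middle_informative (Ihat L s /\ s <= X)
                     then true else false).
  exists (filter p (nodup Req_EM_T l)). split.
  - apply NoDup_filter, NoDup_nodup.
  - intros s. rewrite filter_In, nodup_In. unfold p.
    destruct excluded_middle_informative as [[Hs Hle]|Hs]; split; try tauto.
    + intros _. auto.
    + intros [_ ?]; discriminate.
Qed.

Definition upto (X : R) : list R :=
  proj1_sig (constructive_indefinite_description _ (Ihat_upto_ex X)).

Lemma upto_NoDup X : NoDup (upto X).
Proof. unfold upto. now destruct constructive_indefinite_description. Qed.

Lemma upto_In X s : In s (upto X) <-> Ihat L s /\ s <= X.
Proof. unfold upto. destruct constructive_indefinite_description as [l [? ?]]. apply i. Qed.

Lemma Iset_gt1 s : Iset L s -> 1 < s.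
Proof. intros [Hs Hne]. assert (H := Ihat_ge1 L s Hs). lra. Qed.

Lemma Iset_enumeration : exists s, increasing_enumeration (Iset L) s.
Proof.
  apply locally_finite_enumeration.
  - intros X. destruct (Ihat_finite X) as [l Hl]. exists l. intros x [Hx _]. auto.
  - intros X. destruct (Ihat_unbounded (Rmax 1 X)) as [x [Hx Hlt]]. exists x.
    assert (H1 := Rmax_l 1 X). assert (H2 := Rmax_r 1 X).
    repeat split; trivial; lra.
  - exists 1. exact Iset_gt1.
Qed.

End Exponents.

(** * The integral of a ladder *)

Section Ladder.

Context (L : ladder_data) (C : R -> R) (HC : is_ladder L C).

(** The 1-Lipschitz projection onto [0,1]. The ladder is continuous only within [0,1]; its
    composition with [clamp] is continuous on the whole line and has the same values there. *)
Definition clamp (t : R) : R := Rmax 0 (Rmin 1 t).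

Lemma clamp_unit t : unit_interval (clamp t).
Proof.
  unfold clamp, unit_interval.
  unfold Rmax, Rmin; repeat destruct Rle_dec; lra.
Qed.

Lemma clamp_id t : unit_interval t -> clamp t = t.
Proof.
  unfold clamp, unit_interval.
  unfold Rmax, Rmin; repeat destruct Rle_dec; lra.
Qed.

Lemma clamp_lipschitz t u : Rabs (clamp t - clamp u) <= Rabs (t - u).
Proof.
  unfold clamp, Rmax, Rmin; repeat destruct Rle_dec;
    unfold Rabs; repeat destruct Rcase_abs; lra.
Qed.

Lemma clamped_ladder_continuous t : continuous (fun t => C (clamp t)) t.
Proof.
  assert (Hc := ladder_cont L C HC (clamp t) (clamp_unit t)).
  intros P HP. destruct (Hc P HP) as [eps Heps].
  exists eps. intros u Hu. apply Heps; [|apply clamp_unit].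
  change (Rabs (clamp u - clamp t) < eps).
  change (Rabs (u - t) < eps) in Hu.
  assert (H := clamp_lipschitz u t). lra.
Qed.

Lemma ex_RInt_exp_ladder lam x y : 0 <= x -> x <= y -> y <= 1 ->
  ex_RInt (fun t => exp (lam * C t)) x y.
Proof.
  intros Hx Hxy Hy.
  apply ex_RInt_ext with (fun t => exp (lam * C (clamp t))).
  - rewrite Rmin_left, Rmax_right by trivial. intros t Ht.
    rewrite clamp_id by (unfold unit_interval; lra). reflexivity.
  - apply (ex_RInt_continuous (V := R_CompleteNormedModule)). intros t _.
    apply (continuous_comp (fun t => lam * C (clamp t)) exp).
    + apply (continuous_scal_r lam (fun t => C (clamp t))), clamped_ladder_continuous.
    + apply (ex_derive_continuous (V := R_NormedModule) exp). auto_derive. trivial.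
Qed.

Lemma E_nonneg lam : 0 <= E C lam.
Proof.
  unfold E. apply RInt_ge_0; [lra | apply ex_RInt_exp_ladder; lra|].
  intros t _. apply Rlt_le, exp_pos.
Qed.

Lemma E_le_exp lam : 0 <= lam -> E C lam <= exp lam.
Proof.
  intros Hl. replace (exp lam) with (RInt (fun _ => exp lam) 0 1).
  - unfold E. apply RInt_le; [lra | apply ex_RInt_exp_ladder; lra | apply ex_RInt_const|].
    intros t Ht. assert (H := ladder_range L C HC t ltac:(unfold unit_interval; lra)).
    unfold unit_interval in H.
    destruct (Req_dec (lam * C t) lam) as [->|Hne]; [lra|].
    apply Rlt_le, exp_increasing. nra.
  - rewrite RInt_const. unfold scal; simpl; unfold mult; simpl. ring.
Qed.

(** The affine map [t -> u * t + v] carries the step onto [0,1], where self-similarity turns the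
    integrand into a constant times the one of [E] at [rho k * lam]. *)
Lemma RInt_step lam k : (1 <= k <= steps L)%nat ->
  RInt (fun t => exp (lam * C t)) (a L k) (b L k) =
  len L k * (exp (lam * h L (k - 1)) * E C (rho L k * lam)).
Proof.
  intros Hk.
  assert (Hlt := interval_lt L k Hk). destruct (interval_sub L k Hk) as [Ha Hb].
  assert (Hlen : 0 < len L k) by (unfold len; lra).
  set (u := / len L k). set (v := - a L k / len L k).
  assert (Hu0 : u * a L k + v = 0) by (unfold u, v; field; lra).
  assert (Hu1 : u * b L k + v = 1) by (unfold u, v, len in *; field; lra).
  assert (Hlin := RInt_comp_lin (fun t => exp (rho L k * lam * C t)) u v (a L k) (b L k)).
  rewrite Hu0, Hu1 in Hlin.
  specialize (Hlin (ex_RInt_exp_ladder _ 0 1 ltac:(lra) ltac:(lra) ltac:(lra))).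
  unfold E. rewrite <- Hlin. clear Hlin.
  (* The factor [len L k] in [w] cancels the Jacobian [u] of the substitution. *)
  set (w := len L k * exp (lam * h L (k - 1))).
  assert (Hex : ex_RInt (fun y => scal u (exp (rho L k * lam * C (u * y + v)))) (a L k) (b L k)).
  { apply (ex_RInt_comp_lin (V := R_NormedModule) (fun t => exp (rho L k * lam * C t))). rewrite Hu0, Hu1. apply ex_RInt_exp_ladder; lra. }
  transitivity (RInt (fun y => scal w (scal u (exp (rho L k * lam * C (u * y + v))))) (a L k) (b L k)).
  - apply RInt_ext. intros t Ht.
    rewrite Rmin_left, Rmax_right in Ht by lra.
    rewrite (ladder_step L C HC k t Hk ltac:(lra)).
    replace ((t - a L k) / len L k) with (u * t + v) by (unfold u, v; field; lra).
    unfold scal; simpl; unfold mult; simpl. unfold w, u.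
    rewrite Rmult_plus_distr_l, exp_plus.
    replace (lam * (rho L k * C (/ len L k * t + v)))
      with (rho L k * lam * C (/ len L k * t + v)) by ring.
    field. lra.
  - rewrite (RInt_scal (V := R_CompleteNormedModule)) by trivial.
    unfold w, scal; simpl; unfold mult; simpl. ring.
Qed.

Lemma RInt_flat lam k : (1 <= k <= steps L - 1)%nat ->
  RInt (fun t => exp (lam * C t)) (b L k) (a L (k + 1)) =
  gap L k * exp (lam * h L k).
Proof.
  intros Hk. assert (Hle := interval_ord L k Hk).
  transitivity (RInt (fun _ => exp (lam * h L k)) (b L k) (a L (k + 1))).
  - apply RInt_ext. intros t Ht.
    rewrite Rmin_left, Rmax_right in Ht by lra.
    now rewrite (ladder_flat L C HC k t Hk ltac:(lra)).
  - rewrite RInt_const. reflexivity.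
Qed.

Lemma RInt_to_step lam n : (n <= steps L - 1)%nat ->
  RInt (fun t => exp (lam * C t)) 0 (a L (n + 1)) =
  lsum (fun k => len L k * (exp (lam * h L (k - 1)) * E C (rho L k * lam))
                 + gap L k * exp (lam * h L k)) (seq 1 n).
Proof.
  assert (Hm := steps_ge2 L).
  induction n as [|n IH]; intros Hn.
  - simpl. rewrite a_first. now rewrite RInt_point.
  - replace (S n + 1)%nat with (n + 1 + 1)%nat by lia.
    rewrite seq_S, lsum_app, <- IH by lia. simpl.
    rewrite <- RInt_step, <- RInt_flat by lia.
    replace (S n) with (n + 1)%nat by lia.
    destruct (interval_sub L (n + 1) ltac:(lia)) as [Ha Hb].
    destruct (interval_sub L (n + 1 + 1) ltac:(lia)) as [Ha' Hb'].
    assert (Hlt := interval_lt L (n + 1) ltac:(lia)).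
    assert (Hlt' := interval_lt L (n + 1 + 1) ltac:(lia)).
    assert (Hle := interval_ord L (n + 1) ltac:(lia)).
    rewrite <- (RInt_Chasles _ 0 (a L (n + 1)) (a L (n + 1 + 1))) by (apply ex_RInt_exp_ladder; lra).
    rewrite <- (RInt_Chasles _ (a L (n + 1)) (b L (n + 1)) (a L (n + 1 + 1)))
      by (apply ex_RInt_exp_ladder; lra).
    change plus with Rplus. ring.
Qed.

Lemma E_functional lam :
  E C lam =
  lsum (fun k => len L k * (exp (lam * h L (k - 1)) * E C (rho L k * lam))
                 + gap L k * exp (lam * h L k)) (seq 1 (steps L - 1))
  + len L (steps L) * (exp (lam * h L (steps L - 1)) * E C (rho L (steps L) * lam)).
Proof.
  assert (Hm := steps_ge2 L).
  rewrite <- RInt_to_step, <- RInt_step by lia.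
  replace (steps L - 1 + 1)%nat with (steps L) by lia.
  destruct (interval_sub L (steps L) ltac:(lia)) as [Ha Hb].
  assert (Hlt := interval_lt L (steps L) ltac:(lia)).
  unfold E. rewrite b_last in *.
  rewrite <- (RInt_Chasles _ 0 (a L (steps L)) 1)
    by (apply ex_RInt_exp_ladder; lra).
  reflexivity.
Qed.

(** In the functional equation at [eta * lam] the last step contributes exactly the term subtracted
    in [f], because [eta * rho m = 1] and [eta * h (m - 1) = eta - 1]. The other steps and the gaps
    remain. *)
Lemma f_lsum lam :
  Defs.f L C lam =
  lsum (fun k => len L k * (exp (eta L * lam * h L (k - 1)) * E C (rho L k * eta L * lam))
                 + gap L k * exp (eta L * lam * h L k)) (seq 1 (steps L - 1)).
Proof.
  assert (Hm := steps_ge2 L). assert (He := eta_rho L).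
  unfold Defs.f. rewrite (E_functional (eta L * lam)).
  replace (rho L (steps L) * (eta L * lam)) with lam
    by (rewrite <- Rmult_assoc, (Rmult_comm (rho L _)), He; ring).
  replace (eta L * lam * h L (steps L - 1)) with ((eta L - 1) * lam).
  - rewrite (Rmult_assoc (len L (steps L))), Rplus_minus_r.
    apply lsum_ext. intros k _. do 4 f_equal. ring.
  - rewrite h_pred, h_steps by lia.
    replace (eta L * lam * (1 - rho L (steps L)))
      with (eta L * lam - eta L * rho L (steps L) * lam) by ring.
    rewrite He. ring.
Qed.

End Ladder.

(** * Lengths of the steps and gaps *)

Section Lengths.

Context (L : ladder_data).

Lemma len_pos k : (1 <= k <= steps L)%nat -> 0 < len L k.
Proof. intros Hk. assert (H := interval_lt L k Hk). unfold len. lra. Qed.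

Lemma gap_nonneg k : (1 <= k <= steps L - 1)%nat -> 0 <= gap L k.
Proof. intros Hk. assert (H := interval_ord L k Hk). unfold gap. lra. Qed.

Lemma len_gap_sum n : (n <= steps L - 1)%nat ->
  lsum (fun k => len L k + gap L k) (seq 1 n) = a L (n + 1).
Proof.
  induction n as [|n IH]; intros Hn.
  - simpl. now rewrite a_first.
  - replace (S n + 1)%nat with (n + 1 + 1)%nat by lia.
    rewrite seq_S, lsum_app, IH by lia. simpl. unfold len, gap.
    replace (S n) with (n + 1)%nat by lia. ring.
Qed.

(** The pieces before the last step tile the interval from 0 to its left end. In the estimates below
    these lengths act as weights of total less than 1. *)
Lemma len_gap_total :
  lsum (fun k => len L k + gap L k) (seq 1 (steps L - 1)) = 1 - len L (steps L).
Proof.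
  assert (Hm := steps_ge2 L).
  rewrite len_gap_sum by lia. replace (steps L - 1 + 1)%nat with (steps L) by lia.
  unfold len. rewrite b_last. ring.
Qed.

Lemma last_len_lt1 : len L (steps L) < 1.
Proof.
  assert (Hm := steps_ge2 L). assert (H1 := len_pos 1 ltac:(lia)).
  assert (H2 := gap_nonneg 1 ltac:(lia)).
  assert (H : 0 <= lsum (fun k => len L k + gap L k) (seq 2 (steps L - 2))).
  { apply lsum_nonneg. intros k Hk. apply in_seq in Hk.
    assert (H3 := len_pos k ltac:(lia)). assert (H4 := gap_nonneg k ltac:(lia)). lra. }
  assert (Ht := len_gap_total).
  replace (steps L - 1)%nat with (S (steps L - 2)) in Ht by lia. simpl in Ht. lra.
Qed.

End Lengths.

(** * The periodic factor *)

Lemma exp_le_compat x y : x <= y -> exp x <= exp y.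
Proof. intros [H | ->]; [apply Rlt_le, exp_increasing, H | apply Rle_refl]. Qed.

Section Periodic.

Context (L : ladder_data) (C : R -> R) (HC : is_ladder L C).

Lemma last_len_pos : 0 < len L (steps L).
Proof. assert (Hm := steps_ge2 L). apply len_pos; lia. Qed.

Lemma Rpower_eta_alpha mu : 0 < mu ->
  Rpower (eta L * mu) (alpha L) = len L (steps L) * Rpower mu (alpha L).
Proof.
  intros Hmu. assert (He := eta_gt1 L).
  rewrite <- Rpower_mult_distr by lra. f_equal.
  unfold Rpower, alpha.
  assert (Hln : 0 < ln (eta L)) by (rewrite <- ln_1; apply ln_increasing; lra).
  replace (ln (len L (steps L)) / ln (eta L) * ln (eta L))
    with (ln (len L (steps L))) by (field; lra).
  apply exp_ln, last_len_pos.
Qed.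

Lemma Rpower_eta_pow_alpha n mu : 0 < mu ->
  Rpower (eta L ^ n * mu) (alpha L) = len L (steps L) ^ n * Rpower mu (alpha L).
Proof.
  intros Hmu. assert (He := eta_gt1 L). induction n as [|n IH]; simpl.
  - now rewrite !Rmult_1_l.
  - rewrite Rmult_assoc, Rpower_eta_alpha, IH; [ring|].
    apply Rmult_lt_0_compat; [apply pow_lt; lra | trivial].
Qed.

Lemma E_eta mu : E C (eta L * mu) =
  Defs.f L C mu + len L (steps L) * exp ((eta L - 1) * mu) * E C mu.
Proof. unfold Defs.f. ring. Qed.

(** Bounding [E] by the exponential of its argument, the step and gap with index [k] have
    exponential factor at most [exp (eta * mu * h k)], and [eta * h k <= eta - 1] since
    [eta * g k >= 1]. The weights sum to less than 1. *)
Lemma f_bounds mu : 0 <= mu -> 0 <= Defs.f L C mu <= exp ((eta L - 1) * mu).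
Proof.
  intros Hmu. assert (Hm := steps_ge2 L). assert (He := eta_gt1 L).
  rewrite (f_lsum L C HC). split.
  - apply lsum_nonneg. intros k Hk. apply in_seq in Hk.
    assert (H1 := len_pos L k ltac:(lia)). assert (H2 := gap_nonneg L k ltac:(lia)).
    assert (H3 := exp_pos (eta L * mu * h L (k - 1))).
    assert (H4 := exp_pos (eta L * mu * h L k)).
    assert (H5 := E_nonneg L C HC (rho L k * eta L * mu)).
    apply Rplus_le_le_0_compat; repeat apply Rmult_le_pos; lra.
  - apply Rle_trans with
      (lsum (fun k => exp ((eta L - 1) * mu) * (len L k + gap L k)) (seq 1 (steps L - 1))).
    + apply lsum_le. intros k Hk. apply in_seq in Hk.
      assert (H1 := len_pos L k ltac:(lia)). assert (H2 := gap_nonneg L k ltac:(lia)).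
      assert (Hr := rho_pos L k ltac:(lia)).
      assert (Hexp : exp (eta L * mu * h L k) <= exp ((eta L - 1) * mu)).
      { apply exp_le_compat. assert (Hg := eta_g_ge1 L k ltac:(lia)).
        unfold g in Hg. rewrite Rmult_minus_distr_l, Rmult_1_r in Hg.
        assert (eta L * h L k * mu <= (eta L - 1) * mu)
          by (apply Rmult_le_compat_r; lra). lra. }
      assert (Hre : 0 <= rho L k * eta L) by (apply Rmult_le_pos; lra).
      assert (HE := E_le_exp L C HC (rho L k * eta L * mu)
        (Rmult_le_pos _ _ Hre Hmu)).
      assert (exp (eta L * mu * h L (k - 1)) * E C (rho L k * eta L * mu)
              <= exp (eta L * mu * h L k)).
      { replace (exp (eta L * mu * h L k))
          with (exp (eta L * mu * h L (k - 1)) * exp (rho L k * eta L * mu)).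
        - apply Rmult_le_compat_l; [apply Rlt_le, exp_pos | trivial].
        - rewrite <- exp_plus, h_pred by lia. f_equal. ring. }
      rewrite Rmult_plus_distr_l, !(Rmult_comm (exp ((eta L - 1) * mu))).
      apply Rplus_le_compat; apply Rmult_le_compat_l; lra.
    + rewrite lsum_scal, len_gap_total.
      assert (H1 := exp_pos ((eta L - 1) * mu)). assert (H2 := last_len_pos). nra.
Qed.

(* Equals [E/(lam^alpha exp lam)] at [eta^n lam], up to the factor [lam^alpha]; its
   increments in [n] decay geometrically once [lam] is large. *)
Definition growth_ratio (lam : R) (n : nat) : R :=
  E C (eta L ^ n * lam) * exp (- (eta L ^ n * lam)) / len L (steps L) ^ n.

Lemma growth_ratio_S lam n :
  growth_ratio lam (S n) = growth_ratio lam n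
  + Defs.f L C (eta L ^ n * lam) * exp (- (eta L * (eta L ^ n * lam)))
    / len L (steps L) ^ S n.
Proof.
  unfold growth_ratio. simpl. rewrite Rmult_assoc.
  set (mu := eta L ^ n * lam). rewrite E_eta.
  replace (exp (- mu)) with (exp ((eta L - 1) * mu) * exp (- (eta L * mu))).
  - assert (H := last_len_pos). field. split; try apply pow_nonzero; lra.
  - rewrite <- exp_plus. f_equal. ring.
Qed.

Definition normalized (mu : R) : R := E C mu * exp (- mu) / Rpower mu (alpha L).

(** This makes the two-sided series defining [H] telescope along the orbit of [lam] under
    multiplication by [eta]. *)
Lemma f1_telescopes mu : 0 < mu ->
  f1 L C mu = normalized (eta L * mu) - normalized mu.
Proof.
  intros Hmu. unfold f1, normalized. rewrite Rpower_eta_alpha, E_eta by trivial.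
  assert (H1 := last_len_pos). assert (H2 := exp_pos (alpha L * ln mu)).
  fold (Rpower mu (alpha L)) in H2.
  replace (exp (- mu)) with (exp ((eta L - 1) * mu) * exp (- (eta L * mu))).
  - rewrite exp_Ropp. assert (H3 := exp_pos (eta L * mu)). field. lra.
  - rewrite <- exp_plus. f_equal. ring.
Qed.

Lemma normalized_pow lam n : 0 < lam ->
  normalized (eta L ^ n * lam) = growth_ratio lam n / Rpower lam (alpha L).
Proof.
  intros Hlam. unfold normalized, growth_ratio.
  rewrite Rpower_eta_pow_alpha by trivial.
  assert (H1 := last_len_pos). assert (H2 := exp_pos (alpha L * ln lam)).
  fold (Rpower lam (alpha L)) in H2. field. split; try apply pow_nonzero; lra.
Qed.

Lemma exp_neg_E_bounds mu : 0 <= mu -> 0 <= E C mu * exp (- mu) <= 1.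
Proof.
  intros Hmu. assert (H1 := E_nonneg L C HC mu). assert (H2 := E_le_exp L C HC mu Hmu).
  assert (H3 := exp_pos (- mu)).
  assert (H4 : exp mu * exp (- mu) = 1) by (rewrite <- exp_plus, Rplus_opp_r; apply exp_0).
  nra.
Qed.

(** Towards 0 the factor [E C mu * exp (- mu)] stays at most 1, while dividing by [mu] to the
    negative power [alpha] brings in the geometric factor D^n. So the tail of [H] at negative
    indices telescopes to a null sequence. *)
Lemma normalized_neg_pow lam n : 0 < lam ->
  0 <= normalized (/ eta L ^ n * lam) <= len L (steps L) ^ n / Rpower lam (alpha L).
Proof.
  intros Hlam. assert (He := eta_gt1 L).
  assert (Hp : 0 < eta L ^ n) by (apply pow_lt; lra).
  assert (Hmu : 0 < / eta L ^ n * lam)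
    by (apply Rmult_lt_0_compat; [now apply Rinv_0_lt_compat | trivial]).
  unfold normalized. set (mu := / eta L ^ n * lam) in *.
  replace lam with (eta L ^ n * mu) by (unfold mu; field; lra).
  rewrite Rpower_eta_pow_alpha by trivial.
  assert (H1 := last_len_pos). assert (H2 := exp_pos (alpha L * ln mu)).
  fold (Rpower mu (alpha L)) in H2.
  assert (Hn : 0 < len L (steps L) ^ n) by (apply pow_lt; lra).
  destruct (exp_neg_E_bounds mu ltac:(lra)) as [H3 H4].
  replace (len L (steps L) ^ n / (len L (steps L) ^ n * Rpower mu (alpha L)))
    with (1 / Rpower mu (alpha L)) by (field; lra).
  unfold Rdiv. assert (H5 := Rinv_0_lt_compat _ H2). nra.
Qed.

(** The half with indices [k >= 0] telescopes to [l - normalized lam] and the half with [k < 0] to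
    [normalized lam - 0]; their sum is [l]. *)
Lemma H_limit lam (l : R) : 0 < lam ->
  is_lim_seq (fun n => normalized (eta L ^ n * lam)) l -> H L C lam = l.
Proof.
  intros Hlam Hlim. assert (He := eta_gt1 L).
  unfold H, SeriesZ.
  assert (Hpos : is_series (fun n => f1 L C (powerRZ (eta L) (Z.of_nat n) * lam))
                   (l - normalized lam)).
  { change (is_lim_seq (sum_n (fun n => f1 L C (powerRZ (eta L) (Z.of_nat n) * lam)))
                   (l - normalized lam)).
    apply is_lim_seq_ext with (fun n => normalized (eta L ^ S n * lam) - normalized lam).
    - assert (Hf : forall n, f1 L C (powerRZ (eta L) (Z.of_nat n) * lam) =
          normalized (eta L ^ S n * lam) - normalized (eta L ^ n * lam)).
      { intros n. rewrite <- pow_powerRZ, f1_telescopes.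
        - simpl. now rewrite Rmult_assoc.
        - apply Rmult_lt_0_compat; [apply pow_lt; lra | trivial]. }
      induction n as [|n IH].
      + rewrite sum_O, Hf. simpl. now rewrite Rmult_1_l.
      + rewrite sum_Sn, <- IH, Hf. change plus with Rplus. ring.
    - apply is_lim_seq_minus'; [|apply is_lim_seq_const].
      exact (proj1 (is_lim_seq_incr_1 _ _) Hlim). }
  assert (Hneg : is_series (fun n => f1 L C (powerRZ (eta L) (- Z.of_nat (S n)) * lam))
                   (normalized lam - 0)).
  { change (is_lim_seq (sum_n (fun n => f1 L C (powerRZ (eta L) (- Z.of_nat (S n)) * lam)))
                   (normalized lam - 0)).
    apply is_lim_seq_ext with (fun n => normalized lam - normalized (/ eta L ^ S n * lam)).
    - assert (Hf : forall n, f1 L C (powerRZ (eta L) (- Z.of_nat (S n)) * lam) =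
          normalized (/ eta L ^ n * lam) - normalized (/ eta L ^ S n * lam)).
      { intros n. rewrite powerRZ_neg', <- pow_powerRZ.
        assert (Hp : 0 < eta L ^ n) by (apply pow_lt; lra).
        rewrite f1_telescopes.
        - simpl. do 2 f_equal. field. lra.
        - apply Rmult_lt_0_compat; [apply Rinv_0_lt_compat, pow_lt; lra | trivial]. }
      induction n as [|n IH].
      + rewrite sum_O, Hf. simpl (eta L ^ 0). now rewrite Rinv_1, Rmult_1_l.
      + rewrite sum_Sn, <- IH, Hf. change plus with Rplus. ring.
    - apply is_lim_seq_minus'; [apply is_lim_seq_const|].
      apply -> (is_lim_seq_incr_1 (fun n => normalized (/ eta L ^ n * lam))).
      apply is_lim_seq_le_le with (u := fun _ => 0)
        (w := fun n => len L (steps L) ^ n * / Rpower lam (alpha L)).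
      + intros n. now apply normalized_neg_pow.
      + apply is_lim_seq_const.
      + replace (Finite 0) with (Rbar_mult 0 (/ Rpower lam (alpha L)))
          by (simpl; now rewrite Rmult_0_l).
        apply is_lim_seq_scal_r, is_lim_seq_geom.
        assert (H1 := last_len_pos). assert (H2 := last_len_lt1 L).
        rewrite Rabs_right; lra. }
  rewrite (is_series_unique _ _ Hpos), (is_series_unique _ _ Hneg). ring.
Qed.

Lemma H1_limit lam (l : R) : 0 < lam ->
  is_lim_seq (growth_ratio lam) l -> H1 L C lam = l.
Proof.
  intros Hlam Hlim. unfold H1.
  assert (H2 := exp_pos (alpha L * ln lam)). fold (Rpower lam (alpha L)) in H2.
  rewrite (H_limit lam (l / Rpower lam (alpha L))); [field; lra | trivial|].
  apply is_lim_seq_ext with (fun n => growth_ratio lam n * / Rpower lam (alpha L)).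
  - intros n. now rewrite normalized_pow.
  - exact (is_lim_seq_scal_r _ (/ Rpower lam (alpha L)) _ Hlim).
Qed.

(* Chosen so that both [exp ((1-eta) lam)] and [exp (-lam)] are at most a quarter of
   the length of the last step for [lam] beyond it. *)
Definition threshold : R := ln (4 / len L (steps L)) / min_gap L.

Lemma threshold_pos : 0 < threshold.
Proof.
  assert (H1 := last_len_pos). assert (H2 := last_len_lt1 L). assert (H3 := min_gap_pos L).
  apply Rdiv_lt_0_compat; trivial. rewrite <- ln_1. apply ln_increasing; [lra|].
  apply Rmult_lt_reg_r with (len L (steps L)); trivial.
  unfold Rdiv. rewrite Rmult_assoc, Rinv_l; lra.
Qed.

Lemma exp_beyond_threshold lam r : threshold <= lam -> min_gap L <= r ->
  exp (- (r * lam)) <= len L (steps L) / 4.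
Proof.
  intros Hlam Hr. assert (H1 := last_len_pos). assert (H3 := min_gap_pos L).
  assert (H4 := threshold_pos).
  replace (len L (steps L) / 4) with (exp (- (min_gap L * threshold))).
  - apply exp_le_compat. nra.
  - unfold threshold.
    replace (min_gap L * (ln (4 / len L (steps L)) / min_gap L))
      with (ln (4 / len L (steps L))) by (field; lra).
    rewrite exp_Ropp, exp_ln; [field; lra|]. apply Rdiv_lt_0_compat; lra.
Qed.

Lemma min_gap_le1 : min_gap L <= 1.
Proof. apply Rmin_l. Qed.

Lemma min_gap_le_eta : min_gap L <= eta L - 1.
Proof. apply Rmin_r. Qed.

(** With mu = eta^n lam the increment is at most exp(-mu) / D^(n+1). Beyond the threshold, exp(-mu)
    is at most exp(-lam) (D/4)^n, which beats the powers of D in the denominator. *)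
Lemma growth_ratio_increment lam n : threshold <= lam ->
  0 <= growth_ratio lam (S n) - growth_ratio lam n
    <= exp (- lam) / len L (steps L) * (/ 4) ^ n.
Proof.
  intros Hlam. assert (H0 := threshold_pos). assert (H1 := last_len_pos).
  assert (He := eta_gt1 L).
  rewrite growth_ratio_S, Rplus_minus_l.
  (* Bernoulli's inequality: [eta ^ n * lam] exceeds [lam] by at least n copies of
     [(eta - 1) * lam], each worth a factor D/4. *)
  assert (Hb : 1 + INR n * (eta L - 1) <= eta L ^ n).
  { replace (eta L) with (1 + (eta L - 1)) at 2 by ring. apply poly. lra. }
  assert (Hmu : 0 <= eta L ^ n * lam).
  { apply Rmult_le_pos; [apply pow_le|]; lra. }
  destruct (f_bounds _ Hmu) as [Hf0 Hf1].
  assert (Hq : exp (- ((eta L - 1) * lam)) <= len L (steps L) / 4).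
  { apply exp_beyond_threshold; [trivial | apply min_gap_le_eta]. }
  assert (Hpow : exp (- (INR n * ((eta L - 1) * lam))) <= (len L (steps L) / 4) ^ n).
  { replace (exp (- (INR n * ((eta L - 1) * lam)))) with (exp (- ((eta L - 1) * lam)) ^ n).
    - apply pow_incr. split; [apply Rlt_le, exp_pos | trivial].
    - clear. induction n as [|n IH]; [simpl; now rewrite Rmult_0_l, Ropp_0, exp_0|].
      rewrite S_INR. simpl. rewrite IH, <- exp_plus. f_equal. ring. }
  assert (Hn : 0 < len L (steps L) ^ n) by (apply pow_lt; lra).
  assert (HS : 0 < / len L (steps L) ^ S n)
    by (apply Rinv_0_lt_compat, pow_lt; lra).
  set (mu := eta L ^ n * lam) in *.
  assert (Hup : Defs.f L C mu * exp (- (eta L * mu)) <=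
            exp (- lam) * (len L (steps L) / 4) ^ n).
  { apply Rle_trans with (exp (- lam) * exp (- (INR n * ((eta L - 1) * lam)))).
    - apply Rle_trans with (exp ((eta L - 1) * mu) * exp (- (eta L * mu))).
      + apply Rmult_le_compat_r; [apply Rlt_le, exp_pos | trivial].
      + rewrite <- !exp_plus. apply exp_le_compat.
        assert ((1 + INR n * (eta L - 1)) * lam <= mu)
          by (apply Rmult_le_compat_r; lra). lra.
    - apply Rmult_le_compat_l; [apply Rlt_le, exp_pos | trivial]. }
  split.
  - unfold Rdiv. apply Rmult_le_pos; [|lra]. apply Rmult_le_pos; trivial.
    apply Rlt_le, exp_pos.
  - replace (exp (- lam) / len L (steps L) * (/ 4) ^ n)
      with (exp (- lam) * (len L (steps L) / 4) ^ n * / len L (steps L) ^ S n).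
    + apply Rmult_le_compat_r; lra.
    + unfold Rdiv. rewrite Rpow_mult_distr. simpl. field. lra.
Qed.

Definition remainder (lam : R) : R := E C lam - H1 L C lam * exp lam.

(** The sequence increases with geometrically small increments, so it converges within [2 * M] of
    its first value. The remainder is this difference, with sign reversed, times [exp lam], and
    [M * exp lam] is 1/D. *)
Lemma growth_ratio_limit lam : threshold <= lam ->
  is_lim_seq (growth_ratio lam) (H1 L C lam) /\
  - (2 / len L (steps L)) <= remainder lam <= 0.
Proof.
  intros Hlam. assert (H0 := threshold_pos). assert (H1 := last_len_pos).
  set (M := exp (- lam) / len L (steps L)).
  assert (HM : 0 < M) by (apply Rdiv_lt_0_compat; [apply exp_pos | trivial]).
  assert (Hinc : forall n, 0 <= growth_ratio lam (S n) - growth_ratio lam n <= M * (/ 4) ^ n)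
    by (intros n; now apply growth_ratio_increment).
  (* The factor [1 - (/ 4) ^ n] makes the bound inductive: it grows by (3/2) M / 4^n, more than the
     allowed increment. *)
  assert (Hup : forall n, growth_ratio lam n <= growth_ratio lam 0 + 2 * M * (1 - (/ 4) ^ n)).
  { induction n as [|n IH]; simpl; [lra|]. specialize (Hinc n).
    assert (0 < (/ 4) ^ n) by (apply pow_lt; lra). nra. }
  assert (Hup' : forall n, growth_ratio lam n <= growth_ratio lam 0 + 2 * M).
  { intros n. specialize (Hup n). assert (0 < (/ 4) ^ n) by (apply pow_lt; lra). nra. }
  destruct (ex_finite_lim_seq_incr (growth_ratio lam) (growth_ratio lam 0 + 2 * M))
    as [l Hl]; [intros n; specialize (Hinc n); lra | trivial|].
  rewrite (H1_limit lam l) by (trivial; lra). split; trivial.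
  assert (Hhi : l <= growth_ratio lam 0 + 2 * M).
  { change (Rbar_le l (growth_ratio lam 0 + 2 * M)).
    eapply is_lim_seq_le; [exact Hup' | exact Hl | apply is_lim_seq_const]. }
  assert (Hlo : growth_ratio lam 0 <= l).
  { change (Rbar_le (growth_ratio lam 0) l).
    eapply is_lim_seq_le with (u := fun _ => growth_ratio lam 0);
      [|apply is_lim_seq_const | exact Hl].
    induction n as [|n IH]; [lra|]. specialize (Hinc n). lra. }
  unfold remainder. rewrite (H1_limit lam l) by (trivial; lra).
  assert (He : exp (- lam) * exp lam = 1) by (rewrite <- exp_plus, Rplus_opp_l; apply exp_0).
  assert (H2 := exp_pos lam).
  assert (Hg : growth_ratio lam 0 * exp lam = E C lam).
  { unfold growth_ratio. simpl. rewrite Rmult_1_l.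
    transitivity (E C lam * (exp (- lam) * exp lam)); [field | rewrite He; ring]. }
  assert (HMe : M * exp lam = / len L (steps L)).
  { unfold M. transitivity (exp (- lam) * exp lam / len L (steps L)); [field; lra|].
    rewrite He. field. lra. }
  unfold Rdiv. rewrite <- HMe, <- Hg. split; nra.
Qed.

(** Periodicity of [H] in the logarithm of [lam], seen through the power factor: the growth ratios
    at [eta * lam] are those at [lam], shifted by one index and multiplied by D. *)
Lemma H1_eta lam : threshold <= lam -> H1 L C (eta L * lam) = len L (steps L) * H1 L C lam.
Proof.
  intros Hlam. assert (H0 := threshold_pos). assert (H1 := last_len_pos).
  assert (He := eta_gt1 L).
  apply H1_limit; [apply Rmult_lt_0_compat; lra|].
  apply is_lim_seq_ext with (fun n => len L (steps L) * growth_ratio lam (S n)).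
  - intros n. unfold growth_ratio. simpl.
    replace (eta L * eta L ^ n * lam) with (eta L ^ n * (eta L * lam)) by ring.
    field. split; try apply pow_nonzero; lra.
  - apply (is_lim_seq_scal_l (fun n => growth_ratio lam (S n)) (len L (steps L))
             (Defs.H1 L C lam)).
    apply -> is_lim_seq_incr_1. now apply growth_ratio_limit.
Qed.

(** Divide E = H1 exp + R by the exponential: [R <= 0] gives the lower bound, [R >= -2/D] and
    [E <= exp] the upper one. *)
Lemma H1_bounds lam : threshold <= lam -> 0 <= H1 L C lam <= 1 + 2 / len L (steps L).
Proof.
  intros Hlam. destruct (growth_ratio_limit lam Hlam) as [_ Hr]. unfold remainder in Hr.
  assert (H0 := threshold_pos). assert (H1 := last_len_pos).
  assert (H2 := E_nonneg L C HC lam). assert (H3 := E_le_exp L C HC lam ltac:(lra)).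
  assert (H4 : 1 <= exp lam) by (rewrite <- exp_0; apply exp_le_compat; lra).
  assert (H5 : 0 < 2 / len L (steps L)) by (apply Rdiv_lt_0_compat; lra).
  split; apply Rmult_le_reg_r with (exp lam); nra.
Qed.

End Periodic.

(** * The expansion *)

Section Expansion.

Context (L : ladder_data) (C : R -> R) (HC : is_ladder L C).
Context (Hmin : forall i, (1 <= i <= steps L)%nat -> rho L (steps L) <= rho L i).
Context (c : R -> R -> R) (Hc : is_coefficients L C c).

(* The operator [T], acting simultaneously on the exponent index [X] and on [lam]:
   with this double action, the terms, the partial sums and the remainder all satisfy
   recursions with the same operator. *)
Definition transfer (e : R -> R -> R) (X lam : R) : R :=
  1 / len L (steps L) * exp ((1 - eta L) * lam) * e (X / eta L) (eta L * lam)
  - lsum (fun i => len L i / len L (steps L) * exp ((1 - eta L * (g L i + rho L i)) * lam)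
                   * e ((X / eta L - g L i) / rho L i) (rho L i * eta L * lam))
      (seq 1 (steps L - 1)).

(** The summand of R0 with exponent index [eta * g k]; it collects step [k] and the gap after it. *)
Definition base_term (k : nat) (lam : R) : R :=
  - (len L k * H1 L C (eta L * rho L k * lam) + gap L k) / len L (steps L)
  * exp ((1 - eta L * g L k) * lam).

Definition term (s lam : R) : R := c s lam * exp ((1 - s) * lam).

(** The exponential splits so that each coefficient on the right meets its own index and argument:
    [(1 - s) * lam] equals [(1 - eta) * lam + (1 - s / eta) * (eta * lam)], and similarly for step
    [i]. The leftover factors are the weights of [transfer]. *)
Lemma term_rec s lam : 0 < lam -> Ihat L s ->
  term s lam = Defs.c1 L C s lam * exp ((1 - s) * lam) + transfer term s lam.
Proof.
  intros Hlam Hs. assert (He := eta_gt1 L). assert (Hm := steps_ge2 L).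
  unfold term at 1. rewrite (coef_rec _ _ _ Hc) by trivial.
  unfold c_rec, transfer. rewrite sum_n_m_lsum.
  set (A := Defs.c1 L C s lam).
  rewrite Rmult_minus_distr_r, Rmult_plus_distr_r.
  assert (E1 : 1 / len L (steps L) * c (s / eta L) (eta L * lam) * exp ((1 - s) * lam) =
    1 / len L (steps L) * exp ((1 - eta L) * lam) * term (s / eta L) (eta L * lam)).
  { unfold term. replace ((1 - s) * lam)
      with ((1 - eta L) * lam + (1 - s / eta L) * (eta L * lam)) by (field; lra).
    rewrite exp_plus. ring. }
  rewrite E1, Rplus_minus_assoc. do 2 f_equal.
  rewrite Rmult_comm, <- lsum_scal. apply lsum_ext. intros i Hi. apply in_seq in Hi.
  assert (Hr := rho_pos L i ltac:(lia)).
  unfold term. replace ((1 - s) * lam) with ((1 - eta L * (g L i + rho L i)) * lam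
    + (1 - (s / eta L - g L i) / rho L i) * (rho L i * eta L * lam)) by (field; lra).
  rewrite exp_plus. ring.
Qed.

Definition partial (X lam : R) : R := lsum (fun s => term s lam) (upto L Hmin X).

Lemma lsum_c1 X lam :
  lsum (fun s => Defs.c1 L C s lam * exp ((1 - s) * lam)) (upto L Hmin X) =
  lsum (fun k => if Rle_dec (eta L * g L k) X then base_term k lam else 0)
    (seq 1 (steps L - 1)).
Proof.
  transitivity (lsum (fun s => lsum (fun k =>
      if Req_EM_T s (eta L * g L k) then base_term k lam else 0) (seq 1 (steps L - 1)))
    (upto L Hmin X)).
  - apply lsum_ext. intros s _. unfold Defs.c1. rewrite sum_n_m_lsum.
    rewrite Rmult_comm, <- lsum_scal. apply lsum_ext. intros k _.
    destruct Req_EM_T as [->|]; [unfold base_term|]; ring.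
  - rewrite lsum_exchange. apply lsum_ext. intros k Hk. apply in_seq in Hk.
    rewrite lsum_indicator by apply upto_NoDup.
    destruct in_dec as [Hin|Hin]; rewrite upto_In in Hin; destruct Rle_dec; tauto || exfalso.
    apply Hin. split; trivial. constructor. lia.
Qed.

(** Each index map in [transfer] is the increasing inverse of a closure map, so it carries the bound
    [X] along and hits every exponent below the new bound. Indices sent outside the exponent set
    have coefficient zero. *)
Lemma partial_rec X lam : 0 < lam ->
  partial X lam =
  lsum (fun k => if Rle_dec (eta L * g L k) X then base_term k lam else 0)
    (seq 1 (steps L - 1)) + transfer partial X lam.
Proof.
  intros Hlam. assert (He := eta_gt1 L).
  unfold partial at 1.
  rewrite (lsum_ext _ (fun s => Defs.c1 L C s lam * exp ((1 - s) * lam) + transfer term s lam)).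
  2: { intros s Hs. apply upto_In in Hs. now apply term_rec. }
  rewrite lsum_plus, lsum_c1. f_equal. unfold transfer.
  rewrite lsum_minus, lsum_scal, lsum_exchange. f_equal.
  - f_equal. unfold partial.
    apply (lsum_reindex (fun s => term s (eta L * lam)) (fun s => s / eta L));
      try apply upto_NoDup.
    + intros x y Hxy. apply Rmult_eq_reg_r with (/ eta L); [exact Hxy|].
      apply Rinv_neq_0_compat. lra.
    + intros s Hs. rewrite upto_In in *.
      destruct (classic (Ihat L (s / eta L))) as [Hp|Hp].
      * left. split; trivial. apply Rmult_le_compat_r; [|tauto].
        apply Rlt_le, Rinv_0_lt_compat. lra.
      * right. unfold term. rewrite (coef_out _ _ _ Hc); [ring| |trivial].
        apply Rmult_lt_0_compat; lra.
    + intros y Hy. rewrite upto_In in Hy. exists (eta L * y). split; [|field; lra].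
      apply upto_In. split; [now constructor|].
      replace X with (eta L * (X / eta L)) by (field; lra).
      apply Rmult_le_compat_l; [lra | tauto].
  - apply lsum_ext. intros i Hi. apply in_seq in Hi.
    assert (Hr := rho_pos L i ltac:(lia)).
    rewrite lsum_scal. f_equal. unfold partial.
    apply (lsum_reindex (fun s => term s (rho L i * eta L * lam))
             (fun s => (s / eta L - g L i) / rho L i)); try apply upto_NoDup.
    + intros x y Hxy.
      replace x with (eta L * (g L i + rho L i * ((x / eta L - g L i) / rho L i)))
        by (field; lra).
      rewrite Hxy. field. lra.
    + intros s Hs. rewrite upto_In in *.
      destruct (classic (Ihat L ((s / eta L - g L i) / rho L i))) as [Hp|Hp].
      * left. split; trivial.
        apply Rmult_le_compat_r; [apply Rlt_le, Rinv_0_lt_compat; lra|].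
        apply Rplus_le_compat_r.
        apply Rmult_le_compat_r; [apply Rlt_le, Rinv_0_lt_compat; lra | tauto].
      * right. unfold term. rewrite (coef_out _ _ _ Hc); [ring| |trivial].
        apply Rmult_lt_0_compat; [apply Rmult_lt_0_compat|]; lra.
    + intros y Hy. rewrite upto_In in Hy. exists (eta L * (g L i + rho L i * y)).
      split; [|field; lra].
      apply upto_In. split; [constructor; [lia | tauto]|].
      replace X with (eta L * (g L i + rho L i * ((X / eta L - g L i) / rho L i)))
        by (field; lra).
      apply Rmult_le_compat_l; [lra|]. apply Rplus_le_compat_l.
      apply Rmult_le_compat_l; [lra | tauto].
Qed.

Lemma scaled_beyond lam r : threshold L <= lam -> 1 <= r -> threshold L <= r * lam.
Proof. intros Hlam Hr. assert (H0 := threshold_pos L). nra. Qed.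

(** [E_eta] is solved for [E C lam] and every [E] is split into [H1] times the exponential plus the
    remainder. The main parts at [lam] and [eta * lam] cancel by [H1_eta]; those inside [f],
    together with the gaps, form the base terms. *)
Lemma remainder_rec X lam : threshold L <= lam ->
  remainder L C lam =
  lsum (fun k => base_term k lam) (seq 1 (steps L - 1))
  + transfer (fun _ => remainder L C) X lam.
Proof.
  intros Hlam. assert (H0 := threshold_pos L). assert (H1 := last_len_pos L).
  assert (He := eta_gt1 L).
  assert (Hexp : exp ((1 - eta L) * lam) * exp ((eta L - 1) * lam) = 1).
  { rewrite <- exp_plus, <- exp_0. f_equal. ring. }
  assert (Hexp' : exp ((1 - eta L) * lam) * exp (eta L * lam) = exp lam).
  { rewrite <- exp_plus. f_equal. ring. }
  assert (Hf : 1 / len L (steps L) * exp ((1 - eta L) * lam) * Defs.f L C lam =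
     lsum (fun i => len L i / len L (steps L) * exp ((1 - eta L * (g L i + rho L i)) * lam)
                   * remainder L C (rho L i * eta L * lam)) (seq 1 (steps L - 1))
     - lsum (fun k => base_term k lam) (seq 1 (steps L - 1))).
  { rewrite (f_lsum L C HC), <- lsum_scal, <- lsum_minus.
    apply lsum_ext. intros k Hk. apply in_seq in Hk.
    unfold remainder, base_term.
    replace (eta L * rho L k * lam) with (rho L k * eta L * lam) by ring.
    replace (exp ((1 - eta L * (g L k + rho L k)) * lam))
      with (exp ((1 - eta L) * lam) * exp (eta L * lam * h L (k - 1))).
    2: { rewrite <- exp_plus, h_pred by lia. unfold g. f_equal. ring. }
    replace (exp ((1 - eta L * g L k) * lam))
      with (exp ((1 - eta L) * lam) * exp (eta L * lam * h L k)).
    2: { rewrite <- exp_plus. unfold g. f_equal. ring. }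
    replace (exp (eta L * lam * h L k))
      with (exp (eta L * lam * h L (k - 1)) * exp (rho L k * eta L * lam)).
    2: { rewrite <- exp_plus, h_pred by lia. f_equal. ring. }
    field. lra. }
  unfold transfer.
  set (S1 := lsum (fun k => base_term k lam) _) in *. clearbody S1.
  set (S2 := lsum _ _) in *.
  assert (HS : S1 - S2 = - (1 / len L (steps L) * exp ((1 - eta L) * lam) * Defs.f L C lam))
    by (rewrite Hf; ring).
  replace (S1 + _) with
    (1 / len L (steps L) * exp ((1 - eta L) * lam) * remainder L C (eta L * lam) + (S1 - S2))
    by ring.
  rewrite HS. unfold remainder. rewrite H1_eta, E_eta by trivial.
  transitivity (exp ((1 - eta L) * lam) * exp ((eta L - 1) * lam) * E C lam
    - Defs.H1 L C lam * (exp ((1 - eta L) * lam) * exp (eta L * lam))).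
  - rewrite Hexp, Hexp'. ring.
  - field. lra.
Qed.

(** * Bounds for the base terms and for the transfer operator *)

Lemma exp_base_le1 k lam : (1 <= k <= steps L - 1)%nat -> 0 <= lam ->
  exp ((1 - eta L * g L k) * lam) <= 1.
Proof.
  intros Hk Hlam. assert (Hg := eta_g_ge1 L k ltac:(lia)).
  apply Rle_trans with (exp 0); [apply exp_le_compat; nra | rewrite exp_0; lra].
Qed.

Definition base_bound : R := (1 + 2 / len L (steps L)) / len L (steps L).

Lemma base_bound_pos : 0 < base_bound.
Proof.
  assert (H1 := last_len_pos L). assert (0 < 2 / len L (steps L)) by (apply Rdiv_lt_0_compat; lra).
  apply Rdiv_lt_0_compat; lra.
Qed.

Lemma base_term_bound k lam : (1 <= k <= steps L - 1)%nat -> threshold L <= lam ->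
  Rabs (base_term k lam) <= base_bound * (len L k + gap L k).
Proof.
  intros Hk Hlam. assert (H0 := threshold_pos L). assert (H1 := last_len_pos L).
  assert (Hl := len_pos L k ltac:(lia)). assert (Hg := gap_nonneg L k Hk).
  destruct (H1_bounds L C HC (eta L * rho L k * lam)) as [Hb0 Hb1].
  { apply scaled_beyond; trivial. apply eta_rho_ge1; [trivial | lia]. }
  assert (He := exp_base_le1 k lam Hk ltac:(lra)).
  assert (He0 := exp_pos ((1 - eta L * g L k) * lam)).
  assert (H2 : 0 < 2 / len L (steps L)) by (apply Rdiv_lt_0_compat; lra).
  assert (Hi := Rinv_0_lt_compat _ H1).
  unfold base_term, base_bound. unfold Rdiv at 1.
  set (B := 1 + 2 / len L (steps L)) in *.
  set (y := Defs.H1 L C (eta L * rho L k * lam)) in *.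
  rewrite !Rabs_mult, Rabs_Ropp.
  rewrite (Rabs_right (exp _)), (Rabs_right (/ _)), (Rabs_right (_ + _))
    by (apply Rle_ge; try apply Rplus_le_le_0_compat; try apply Rmult_le_pos; lra).
  unfold Rdiv.
  assert (HB : 1 < B) by (unfold B; lra). clearbody B y.
  assert (Hn : len L k * y + gap L k <= B * (len L k + gap L k)) by nra.
  apply Rle_trans with ((len L k * y + gap L k) * / len L (steps L) * 1).
  - apply Rmult_le_compat_l; trivial.
    apply Rmult_le_pos; [apply Rplus_le_le_0_compat; [apply Rmult_le_pos|]|]; lra.
  - replace (B * / len L (steps L) * (len L k + gap L k))
      with (B * (len L k + gap L k) * / len L (steps L)) by ring.
    rewrite Rmult_1_r. apply Rmult_le_compat_r; lra.
Qed.

(** Each of the two parts is at most K/4. Beyond the threshold exp((1 - eta) lam) / D is at most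
    1/4; in the sum, [eta * (g i + rho i) >= 2] makes each exponential at most exp(-lam), and the
    lengths sum to less than 1. *)
Lemma transfer_bound e K X lam : threshold L <= lam -> 0 <= K ->
  Rabs (e (X / eta L) (eta L * lam)) <= K ->
  (forall i, (1 <= i <= steps L - 1)%nat ->
     Rabs (e ((X / eta L - g L i) / rho L i) (rho L i * eta L * lam)) <= K) ->
  Rabs (transfer e X lam) <= K / 2.
Proof.
  intros Hlam HK He0 Hei. assert (H0 := threshold_pos L). assert (H1 := last_len_pos L).
  assert (H2 := last_len_lt1 L). assert (He := eta_gt1 L).
  assert (Hi := Rinv_0_lt_compat _ H1).
  assert (Hquarter : forall r, min_gap L <= r ->
    / len L (steps L) * exp (- (r * lam)) <= / 4).
  { intros r Hr. assert (Hq := exp_beyond_threshold L lam r Hlam Hr).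
    apply Rmult_le_reg_l with (len L (steps L)); trivial.
    rewrite <- Rmult_assoc, Rinv_r by lra. lra. }
  assert (Ha : Rabs (1 / len L (steps L) * exp ((1 - eta L) * lam)
                     * e (X / eta L) (eta L * lam)) <= / 4 * K).
  { rewrite Rabs_mult. apply Rmult_le_compat; try apply Rabs_pos; trivial.
    rewrite Rabs_right.
    - assert (Hq := Hquarter (eta L - 1) (min_gap_le_eta L)).
      replace ((1 - eta L) * lam) with (- ((eta L - 1) * lam)) by ring. lra.
    - apply Rle_ge, Rmult_le_pos; [lra | apply Rlt_le, exp_pos]. }
  unfold transfer. set (S := lsum _ _).
  assert (Hb : Rabs S <= / 4 * K).
  { unfold S. eapply Rle_trans; [apply lsum_abs|].
    apply Rle_trans with (lsum (fun i => / 4 * K * (len L i + gap L i)) (seq 1 (steps L - 1))).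
    - apply lsum_le. intros i Hii. apply in_seq in Hii.
      assert (Hl := len_pos L i ltac:(lia)). assert (Hg := gap_nonneg L i ltac:(lia)).
      specialize (Hei i ltac:(lia)). rewrite Rabs_mult, Rabs_right.
      2: { apply Rle_ge, Rmult_le_pos; [|apply Rlt_le, exp_pos].
           apply Rmult_le_pos; lra. }
      assert (Hq := Hquarter 1 (min_gap_le1 L)).
      assert (Hexp : exp ((1 - eta L * (g L i + rho L i)) * lam) <= exp (- (1 * lam))).
      { apply exp_le_compat. assert (Hg1 := eta_g_ge1 L i ltac:(lia)).
        assert (Hr1 := eta_rho_ge1 L Hmin i ltac:(lia)). nra. }
      assert (Hc' : / len L (steps L) * exp ((1 - eta L * (g L i + rho L i)) * lam) <= / 4).
      { eapply Rle_trans; [apply Rmult_le_compat_l; [lra | exact Hexp] | exact Hq]. }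
      apply Rle_trans with (len L i * / 4 * K).
      + apply Rmult_le_compat; trivial.
        * apply Rmult_le_pos; [apply Rmult_le_pos; lra | apply Rlt_le, exp_pos].
        * apply Rabs_pos.
        * unfold Rdiv. rewrite Rmult_assoc. apply Rmult_le_compat_l; lra.
      + nra.
    - rewrite lsum_scal, len_gap_total. nra. }
  eapply Rle_trans; [apply Rabs_triang|]. rewrite Rabs_Ropp. lra.
Qed.

(** * Boundedness and decay of the truncation error *)

Definition error (X lam : R) : R := remainder L C lam - partial X lam.

Lemma error_rec X lam : threshold L <= lam ->
  error X lam =
  lsum (fun k => if Rle_dec (eta L * g L k) X then 0 else base_term k lam)
    (seq 1 (steps L - 1)) + transfer error X lam.
Proof.
  intros Hlam. assert (H0 := threshold_pos L).
  unfold error at 1. rewrite (remainder_rec X), partial_rec by (trivial; lra).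
  replace (transfer error X lam)
    with (transfer (fun _ => remainder L C) X lam - transfer partial X lam).
  - rewrite (lsum_ext (fun k => if Rle_dec (eta L * g L k) X then 0 else base_term k lam)
      (fun k => base_term k lam
                - (if Rle_dec (eta L * g L k) X then base_term k lam else 0))).
    + rewrite lsum_minus. ring.
    + intros k _. destruct Rle_dec; ring.
  - unfold transfer, error.
    rewrite (lsum_ext (fun i => _ * (remainder L C _ - partial _ _))
      (fun i => len L i / len L (steps L) * exp ((1 - eta L * (g L i + rho L i)) * lam)
                * remainder L C (rho L i * eta L * lam)
              - len L i / len L (steps L) * exp ((1 - eta L * (g L i + rho L i)) * lam)
                * partial ((X / eta L - g L i) / rho L i) (rho L i * eta L * lam)))
      by (intros; ring).
    rewrite lsum_minus. ring.
Qed.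

Lemma eta_lam_beyond lam : threshold L <= lam -> threshold L <= eta L * lam.
Proof. intros Hlam. assert (He := eta_gt1 L). apply scaled_beyond; lra. Qed.

Lemma rho_eta_lam_beyond i lam : (1 <= i <= steps L - 1)%nat ->
  threshold L <= lam -> threshold L <= rho L i * eta L * lam.
Proof.
  intros Hi Hlam. apply scaled_beyond; trivial.
  rewrite Rmult_comm. apply eta_rho_ge1; [trivial | lia].
Qed.

(** The first summand bounds the remainder alone, where the partial sum is empty. The second makes
    the bound stable under the recursion: half of it plus [base_bound] does not exceed it. *)
Definition error_bound : R := 2 / len L (steps L) + 2 * base_bound.

(* Induction on [X]: the indices occurring in [transfer] are below 1, where the partial
   sum is empty, or smaller than [X] by at least [min_gap]. *)
Lemma error_bounded X lam : threshold L <= lam -> Rabs (error X lam) <= error_bound.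
Proof.
  assert (Hd := min_gap_pos L). assert (Hd1 := min_gap_le1 L).
  assert (Hd2 := min_gap_le_eta L). assert (He := eta_gt1 L).
  assert (H1 := last_len_pos L). assert (HB := base_bound_pos).
  assert (H2 : 0 < 2 / len L (steps L)) by (apply Rdiv_lt_0_compat; lra).
  assert (Hn : forall n X lam, X < 1 + INR n * min_gap L -> threshold L <= lam ->
    Rabs (error X lam) <= error_bound).
  { clear X lam. induction n as [|n IH]; intros X lam HX Hlam.
    - simpl in HX. unfold error, partial.
      destruct (upto L Hmin X) as [|s l] eqn:Hl.
      + simpl. rewrite Rminus_0_r.
        destruct (growth_ratio_limit L C HC lam Hlam) as [_ Hr].
        unfold error_bound. apply Rabs_le. lra.
      + exfalso. assert (Hs : In s (upto L Hmin X)) by (rewrite Hl; now left).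
        apply upto_In in Hs as [Hs Hle]. assert (H := Ihat_ge1 L s Hs). lra.
    - rewrite S_INR in HX. assert (Hn0 := pos_INR n).
      assert (Hnd : 0 <= INR n * min_gap L) by (apply Rmult_le_pos; lra).
      rewrite error_rec by trivial. eapply Rle_trans; [apply Rabs_triang|].
      assert (Ht : Rabs (transfer error X lam) <= error_bound / 2).
      { apply transfer_bound; trivial.
        - unfold error_bound. lra.
        - apply IH; [|now apply eta_lam_beyond].
          assert (HXe : X = eta L * (X / eta L)) by (field; lra).
          set (p := X / eta L) in *. destruct (Rlt_le_dec p 1); [lra|]. nra.
        - intros i Hi. apply IH; [|now apply rho_eta_lam_beyond].
          assert (Hr := rho_pos L i ltac:(lia)).
          assert (Hg1 := eta_g_ge1 L i ltac:(lia)).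
          assert (Hr1 := eta_rho_ge1 L Hmin i ltac:(lia)).
          assert (HXe : X = eta L * (g L i + rho L i * ((X / eta L - g L i) / rho L i)))
            by (field; lra).
          set (p := (X / eta L - g L i) / rho L i) in *.
          destruct (Rlt_le_dec p 1); [lra|]. nra. }
      assert (Hs : Rabs (lsum (fun k => if Rle_dec (eta L * g L k) X then 0
                 else base_term k lam) (seq 1 (steps L - 1))) <= base_bound).
      { eapply Rle_trans; [apply lsum_abs|].
        apply Rle_trans with
          (lsum (fun k => base_bound * (len L k + gap L k)) (seq 1 (steps L - 1))).
        - apply lsum_le. intros k Hk. apply in_seq in Hk.
          destruct Rle_dec; [|apply base_term_bound; [lia | trivial]].
          rewrite Rabs_R0. assert (Hl := len_pos L k ltac:(lia)).
          assert (Hg := gap_nonneg L k ltac:(lia)). apply Rmult_le_pos; lra.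
        - rewrite lsum_scal, len_gap_total. nra. }
      unfold error_bound in *. lra. }
  destruct (archimed (X / min_gap L)) as [Hup _].
  apply (Hn (Z.to_nat (up (X / min_gap L)))).
  assert (IZR (up (X / min_gap L)) <= INR (Z.to_nat (up (X / min_gap L)))).
  { rewrite INR_IZR_INZ. apply IZR_le. lia. }
  assert (X / min_gap L * min_gap L = X) by (field; lra). nra.
Qed.

Lemma rho_le1 i : (1 <= i <= steps L)%nat -> rho L i <= 1.
Proof.
  intros Hi. assert (Hp := h_pred L i ltac:(lia)).
  assert (H1 := h_monotone L 0 (i - 1) ltac:(lia)).
  assert (H2 := h_monotone L i (steps L) ltac:(lia)).
  rewrite h_0 in H1. rewrite h_steps in H2. lra.
Qed.

(** For [X >= eta] every base exponent [eta * g k] is already included, so the error equals its own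
    transfer and each round halves the bound. *)
Lemma error_decay n : exists X0, 0 <= X0 /\ forall X lam, X0 <= X -> threshold L <= lam ->
  Rabs (error X lam) <= error_bound * (/ 2) ^ n.
Proof.
  assert (He := eta_gt1 L). assert (H1 := last_len_pos L). assert (HB := base_bound_pos).
  assert (H2 : 0 < 2 / len L (steps L)) by (apply Rdiv_lt_0_compat; lra).
  induction n as [|n [X0 [HX0 IH]]].
  - exists 0. split; [lra|]. intros X lam _ Hlam. simpl. rewrite Rmult_1_r.
    now apply error_bounded.
  (* With [X / eta >= 1 + X0], the bounds [g i <= 1] and [rho i <= 1] keep all transferred indices
     at least [X0]. *)
  - exists (eta L * (1 + X0)). split; [apply Rmult_le_pos; lra|].
    intros X lam HX Hlam.
    assert (Hp : 1 + X0 <= X / eta L).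
    { apply Rmult_le_reg_l with (eta L); [lra|].
      replace (eta L * (X / eta L)) with X by (field; lra). trivial. }
    rewrite error_rec, (lsum_ext _ (fun _ => 0)), lsum_const0, Rplus_0_l; trivial.
    + replace (error_bound * (/ 2) ^ S n) with (error_bound * (/ 2) ^ n / 2)
        by (simpl; field).
      apply transfer_bound; trivial.
      * unfold error_bound. apply Rmult_le_pos; [lra | apply pow_le; lra].
      * apply IH; [lra | now apply eta_lam_beyond].
      * intros i Hi. apply IH; [|now apply rho_eta_lam_beyond].
        assert (Hr := rho_pos L i ltac:(lia)). assert (Hr1 := rho_le1 i ltac:(lia)).
        assert (Hg := g_le1 L i ltac:(lia)).
        apply Rmult_le_reg_l with (rho L i); trivial.
        replace (rho L i * ((X / eta L - g L i) / rho L i)) with (X / eta L - g L i)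
          by (field; lra). nra.
    + intros k Hk. apply in_seq in Hk. assert (Hg := g_le1 L k ltac:(lia)).
      destruct Rle_dec as [|Hn]; trivial. exfalso. apply Hn. nra.
Qed.

(** The exponent set of the partial sum has the extra element 1, whose exponential factor is 1. Both
    [s N] and the last summand are included, so there are [N + 1] terms besides [c 1]. *)
Lemma partial_enumeration s N lam : increasing_enumeration (Iset L) s ->
  partial (s N) lam = c 1 lam + sum_n (fun n => term (s n) lam) N.
Proof.
  intros Hs. assert (Hle := enumeration_le _ _ Hs). destruct Hs as [_ HA].
  assert (Hgt : forall n, 1 < s n).
  { intros n. apply (Iset_gt1 L). apply HA. eauto. }
  rewrite sum_n_lsum.
  transitivity (lsum (fun x => term x lam) (1 :: map s (seq 0 (S N)))).
  - apply lsum_same; [apply upto_NoDup | |].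
    + constructor.
      * intros Hin. apply in_map_iff in Hin as [n [Hn _]]. specialize (Hgt n). lra.
      * apply FinFun.Injective_map_NoDup; [|apply seq_NoDup].
        intros i j Hij. apply Nat.le_antisymm; apply Hle; lra.
    + intros x. rewrite upto_In.
      change (In x (1 :: map s (seq 0 (S N))))
        with (1 = x \/ In x (map s (seq 0 (S N)))). split.
      * intros [Hx Hxle]. destruct (Req_dec x 1) as [->|Hne]; [now left|right].
        destruct (proj1 (HA x) (conj Hx Hne)) as [n ->].
        apply in_map, in_seq. apply Hle in Hxle. lia.
      * intros [<-|Hx].
        -- split; [apply Ihat_1 | apply Rlt_le, Hgt].
        -- apply in_map_iff in Hx as [n [<- Hn]]. apply in_seq in Hn. split.
           ++ apply (proj2 (HA (s n))). eauto.
           ++ apply Hle. lia.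
  - change (term 1 lam + lsum (fun x => term x lam) (map s (seq 0 (S N))) =
            c 1 lam + lsum (fun n => term (s n) lam) (seq 0 (S N))).
    rewrite lsum_map. unfold term at 1.
    replace ((1 - 1) * lam) with 0 by ring. rewrite exp_0. ring.
Qed.

(** As 1 is the least exponent, every coefficient on the right of its recursion has an index below 1
    and vanishes. Only [c1] is left, where strict growth of [h] singles out [k = m - 1]. *)
Lemma coefficient_1 lam : 0 < lam ->
  c 1 lam = - (gap L (steps L - 1) / len L (steps L)
    + len L (steps L - 1) * H L C (rho L (steps L - 1) / rho L (steps L) * lam)
      * Rpower (rho L (steps L - 1) * lam) (alpha L)).
Proof.
  intros Hlam. assert (Hm := steps_ge2 L). assert (He := eta_gt1 L).
  assert (H1 := last_len_pos L).
  assert (Hrm := rho_pos L (steps L - 1) ltac:(lia)).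
  assert (Hrs := rho_pos L (steps L) ltac:(lia)).
  assert (Hind : forall k, (1 <= k <= steps L - 1)%nat ->
    eta L * g L k = 1 -> k = (steps L - 1)%nat).
  { intros k Hk Hone. assert (Heta := eta_rho L).
    assert (Hgk : g L k = rho L (steps L)).
    { apply Rmult_eq_reg_l with (eta L); lra. }
    destruct (Nat.eq_dec k (steps L - 1)) as [|Hne]; trivial. exfalso.
    assert (Hmon := h_monotone L (S k) (steps L - 1) ltac:(lia)).
    assert (Hr := rho_pos L (S k) ltac:(lia)). rewrite h_S in Hmon.
    unfold g in Hgk. rewrite h_pred, h_steps in Hmon by lia. lra. }
  rewrite (coef_rec _ _ _ Hc) by (trivial; apply Ihat_1).
  unfold c_rec. rewrite (coef_out _ _ _ Hc).
  2: { apply Rmult_lt_0_compat; lra. }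
  2: { intros HI. assert (H := Ihat_ge1 L _ HI).
       assert (1 / eta L * eta L = 1) by (field; lra). nra. }
  rewrite sum_n_m_lsum, (lsum_ext _ (fun _ => 0)), lsum_const0.
  2: { intros i Hi. apply in_seq in Hi. assert (Hr := rho_pos L i ltac:(lia)).
       rewrite (coef_out _ _ _ Hc); [ring| |].
       - apply Rmult_lt_0_compat; [apply Rmult_lt_0_compat|]; lra.
       - intros HI. assert (H := Ihat_ge1 L _ HI).
         assert (Hg := eta_g_ge1 L i ltac:(lia)).
         assert (Hx : eta L * (g L i + rho L i * ((1 / eta L - g L i) / rho L i)) = 1)
           by (field; lra).
         set (p := (1 / eta L - g L i) / rho L i) in *.
         assert (0 < eta L * rho L i) by (apply Rmult_lt_0_compat; lra). nra. }
  unfold Defs.c1. rewrite sum_n_m_lsum.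
  replace (steps L - 1)%nat with (S (steps L - 2)) at 1 by lia.
  rewrite seq_S, lsum_app, (lsum_ext _ (fun _ => 0)), lsum_const0.
  2: { intros k Hk. apply in_seq in Hk. destruct Req_EM_T as [Hone|]; trivial.
       specialize (Hind k ltac:(lia) (eq_sym Hone)). lia. }
  simpl. replace (S (steps L - 2)) with (steps L - 1)%nat by lia.
  assert (Hlast : eta L * g L (steps L - 1) = 1).
  { unfold g. rewrite h_pred, h_steps by lia. rewrite <- (eta_rho L). ring. }
  destruct Req_EM_T as [_|Hne]; [|now rewrite Hlast in Hne].
  unfold Defs.H1.
  replace (rho L (steps L - 1) / rho L (steps L)) with (eta L * rho L (steps L - 1))
    by (unfold eta; field; lra).
  (* Pulling [eta] out of the power produces a factor D, which cancels the denominator of [c1]. *)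
  rewrite (Rmult_assoc (eta L) _ lam), Rpower_eta_alpha
    by (apply Rmult_lt_0_compat; lra).
  field. lra.
Qed.

Lemma uniform_expansion s : increasing_enumeration (Iset L) s ->
  forall eps, 0 < eps -> exists N0, forall N lam, (N0 <= N)%nat -> threshold L <= lam ->
  Rabs (sum_n (fun n => term (s n) lam) N - (remainder L C lam - c 1 lam)) < eps.
Proof.
  intros Hs eps Heps.
  assert (HB : 0 < error_bound).
  { assert (H1 := last_len_pos L). assert (HB := base_bound_pos).
    assert (0 < 2 / len L (steps L)) by (apply Rdiv_lt_0_compat; lra).
    unfold error_bound. lra. }
  destruct (pow_lt_1_zero (/ 2)) with (y := eps / error_bound) as [n Hn].
  { rewrite Rabs_right; lra. }
  { now apply Rdiv_lt_0_compat. }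
  specialize (Hn n (le_n n)).
  rewrite Rabs_right in Hn by (apply Rle_ge, pow_le; lra).
  destruct (error_decay n) as [X0 [HX0 HX]].
  (* An exponent beyond [1 + X0] differs from 1, hence appears in the enumeration, and it forces
     [s N >= X0] for all later [N]. *)
  destruct (Ihat_unbounded L (1 + X0)) as [x [Hx Hlt]].
  destruct (proj1 (proj2 Hs x)) as [N0 HN0]; [split; [trivial | lra]|].
  exists N0. intros N lam HN Hlam.
  apply (enumeration_le _ _ Hs) in HN. specialize (HX (s N) lam ltac:(lra) Hlam).
  unfold error in HX. rewrite (partial_enumeration s N lam Hs) in HX.
  rewrite Rabs_minus_sym.
  replace (remainder L C lam - c 1 lam - sum_n (fun n => term (s n) lam) N)
    with (remainder L C lam - (c 1 lam + sum_n (fun n => term (s n) lam) N)) by ring.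
  eapply Rle_lt_trans; [exact HX|].
  replace eps with (error_bound * (eps / error_bound)) by (field; lra).
  now apply Rmult_lt_compat_l.
Qed.

End Expansion.

Theorem theorem3 (L : ladder_data) (C : R -> R) (HC : is_ladder L C)
    (Hmin : forall i, (1 <= i <= steps L)%nat -> rho L (steps L) <= rho L i)
    (c : R -> R -> R) (Hc : is_coefficients L C c) :
  (forall s, Iset L s -> 1 < s) /\
  exists s : nat -> R, increasing_enumeration (Iset L) s /\
  exists Lam : R, 0 < Lam /\
    CVU_dom (fun N lam => sum_n (fun n => c (s n) lam * exp ((1 - s n) * lam)) N)
            (fun lam => Lam <= lam) /\
    forall lam, Lam <= lam ->
      E C lam =
        H L C lam * Rpower lam (alpha L) * exp lam
        - (gap L (steps L - 1) / len L (steps L)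
           + len L (steps L - 1)
             * H L C (rho L (steps L - 1) / rho L (steps L) * lam)
             * Rpower (rho L (steps L - 1) * lam) (alpha L))
        + Series (fun n => c (s n) lam * exp ((1 - s n) * lam)).
Proof.
  split; [exact (Iset_gt1 L)|].
  destruct (Iset_enumeration L Hmin) as [s Hs].
  exists s. split; [trivial|].
  exists (threshold L). split; [apply threshold_pos|].
  assert (Hu := uniform_expansion L C HC Hmin c Hc s Hs).
  assert (Hlim : forall lam, threshold L <= lam ->
    is_lim_seq (fun N => sum_n (fun n => c (s n) lam * exp ((1 - s n) * lam)) N)
      (remainder L C lam - c 1 lam)).
  { intros lam Hlam. apply is_lim_seq_spec. intros eps.
    destruct (Hu eps (cond_pos eps)) as [N0 HN0].
    exists N0. intros N HN. now apply HN0. }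
  split.
  - intros eps. destruct (Hu eps (cond_pos eps)) as [N0 HN0].
    exists N0. intros N HN lam Hlam.
    (* [CVU_dom] compares with the pointwise [Lim_seq], which is replaced by its known value. *)
    rewrite (is_lim_seq_unique _ _ (Hlim lam Hlam)). now apply HN0.
  - intros lam Hlam. assert (H0 := threshold_pos L).
    rewrite (is_series_unique _ _ (Hlim lam Hlam)).
    rewrite (coefficient_1 L C c Hc lam) by lra.
    unfold remainder, H1. ring.
Qed.
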